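(* Let $\alpha>0$, $s>1/2$, $L>0$ and $t\in\mathbb R$ be arbitrary. Then there is a constant $C(\alpha)>0$, depending on the privacy parameter $\alpha$ (and possibly on the fixed quantities $s,L$) but not on $n$, such that $$\inf_{\substack{\widehat\ell\in\sigma(Z)\\ Q\in\mathcal Q_{\alpha,0}}}\ \sup_{f\in\mathcal S(s,L)}\mathbf E\big[(\widehat\ell-f(t))^2\big]\ \ge\ C(\alpha)\,n^{-\frac{2s-1}{2s+1}},$$ where the infimum is taken over all privacy mechanisms $Q$ providing local $(\alpha,0)$-differential privacy and over all estimators $\widehat\ell$ that are measurable functions of the private views $Z=(Z_1,\dots,Z_n)$ generated by $Q$.
   Context: Data: $X_1,\dots,X_n$ are i.i.d. real random variables with unknown probability density $f$; expectations are taken with respect to the joint law of the data and the privatization. Sobolev ellipsoid: for $s>1/2$, $L>0$, $$\mathcal S(s,L)=\Big\{f:\mathbb R\to[0,\infty):\ \int f(x)\,dx=1,\ \int|\mathcal F[f](\omega)|^2|\omega|^{2s}\,d\omega\le 2\pi L^2\Big\},$$ where $\mathcal F[f](\omega)=\int e^{\mathrm i\omega x}f(x)\,dx$. Since $s>1/2$, each such $f$ agrees a.e. with a continuous function, and $f(t)$ denotes the value of this continuous version at $t$. Privacy: a privacy mechanism is a Markov kernel $Q_i$ from $(\mathbb R,\mathcal B(\mathbb R))$ to some measurable space $(\mathfrak Z,\mathscr Z)$ (which may be arbitrary); given $X_i=x$, the private view $Z_i$ is drawn from $Q_i(\cdot\mid X_i=x)$. The setting is non-interactive: conditionally on $X_1,\dots,X_n$,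 the $Z_i$ are independent and the law of $Z_i$ depends only on $X_i$. $Q$ stands for the mechanisms used by the $n$ data holders. For $\alpha\ge0$, $\beta\in[0,1]$, $Q\in\mathcal Q_{\alpha,\beta}$ (local $(\alpha,\beta)$-differential privacy) means that each mechanism satisfies $$Q_i(A\mid X_i=x)\le e^{\alpha}Q_i(A\mid X_i=x')+\beta\qquad\text{for all }x,x'\in\mathbb R,\ A\in\mathscr Z.$$ *)

(* Defs.v *)
From HB Require Import structures.
From mathcomp Require Import all_boot all_order all_algebra.
From mathcomp Require Import complex.
From mathcomp Require Import all_classical all_reals all_analysis.

Set Implicit Arguments.
Unset Strict Implicit.
Unset Printing Implicit Defensive.

Import Order.TTheory GRing.Theory Num.Theory.
Import numFieldNormedType.Exports.

Local Open Scope classical_set_scope.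
Local Open Scope ring_scope.

(* \int e^{i w x} f(x) dx, with the real and imaginary parts of the integrand
   integrated separately: the library integrates real functions only. *)
Definition fourier (R : realType) (f : R -> R) (w : R) : R[i] :=
  ((\int[@lebesgue_measure R]_x (cos (w * x) * f x)) +i*
   (\int[@lebesgue_measure R]_x (sin (w * x) * f x)))%C.

Definition probability_density (R : realType) (f : R -> R) : Prop :=
  [/\ measurable_fun [set: R] f,
      forall x, 0 <= f x
    & (\int[@lebesgue_measure R]_x (f x)%:E)%E = 1%E].

Definition sobolev_ellipsoid (R : realType) (s L : R) : set (R -> R) :=
  [set f | probability_density f /\
    (\int[@lebesgue_measure R]_w
       (Normc.normc (fourier f w) ^+ 2 * `|w| `^ (2 * s))%:E
     <= (2 * pi * L ^+ 2)%:E)%E].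

(* The continuous function that agrees with f almost everywhere; it is unique,
   and it exists when f is in a Sobolev ellipsoid with s > 1/2.  The default
   value f is used only when there is none. *)
Definition continuous_version (R : realType) (f : R -> R) : R -> R :=
  xget f [set g : R -> R | continuous g /\
    {ae @lebesgue_measure R, forall x, g x = f x}].

Definition locally_private (R : realType) (n : nat) (alpha beta : R)
    d (T : measurableType d) (Q : 'I_n -> R.-pker R ~> T) : Prop :=
  forall (i : 'I_n) (x x' : R) (A : set T), measurable A ->
    (Q i x A <= (expR alpha)%:E * Q i x' A + beta%:E)%E.

Definition iid_density (R : realType) (n : nat) (f : R -> R)
    d (W : measurableType d) (P : probability W R)
    (X : 'I_n -> {RV P >-> R}) : Prop :=
  forall A : 'I_n -> set R, (forall i, measurable (A i)) ->
    P [set w | forall i, A i (X i w)] =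
      (\prod_(i < n) \int[@lebesgue_measure R]_(x in A i) (f x)%:E)%E.

(* Given X = (X_1, ..., X_n), the Z_i are independent and Z_i has conditional
   law Q_i(. | X_i): this says that \prod_i Q_i(B_i | X_i) is a version of the
   conditional probability of {Z_1 \in B_1, ..., Z_n \in B_n} given sigma(X). *)
Definition noninteractive_views (R : realType) (n : nat)
    d (T : measurableType d) (Q : 'I_n -> R.-pker R ~> T)
    d' (W : measurableType d') (P : probability W R)
    (X : 'I_n -> {RV P >-> R}) (Z : 'I_n -> {RV P >-> T}) : Prop :=
  forall (A : set (n.-tuple R)) (B : 'I_n -> set T),
    measurable A -> (forall i, measurable (B i)) ->
    P [set w | A [tuple X i w | i < n] /\ forall i, B i (Z i w)] =
      (\int[P]_(w in [set w | A [tuple X i w | i < n]])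
         \prod_(i < n) Q i (X i w) (B i))%E.

(* The supremum runs over the densities f and over the probability spaces
   carrying data and views with the prescribed joint law; the expectation
   depends on that law only, so for each f it takes a single value. *)
Definition worst_case_risk (R : realType) (n : nat) (s L t : R)
    d (T : measurableType d) (Q : 'I_n -> R.-pker R ~> T)
    (ell : n.-tuple T -> R) : \bar R :=
  ereal_sup [set r : \bar R | exists f : R -> R, sobolev_ellipsoid s L f /\
    exists (d' : measure_display) (W : measurableType d')
           (P : probability W R)
           (X : 'I_n -> {RV P >-> R}) (Z : 'I_n -> {RV P >-> T}),
      [/\ iid_density f X, noninteractive_views Q X Z
        & r = ('E_P[(fun w => (ell [tuple Z i w | i < n]
                               - continuous_version f t) ^+ 2)%R])%E]].

(* The space T of the private views is arbitrary, so the infimum runs over it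
   as well. *)
Definition private_minimax_risk (R : realType) (n : nat)
    (alpha beta s L t : R) : \bar R :=
  ereal_inf [set r : \bar R |
    exists (d : measure_display) (T : measurableType d)
           (Q : 'I_n -> R.-pker R ~> T) (ell : n.-tuple T -> R),
      [/\ locally_private alpha beta Q, measurable_fun [set: n.-tuple T] ell
        & r = worst_case_risk s L t Q ell]].

(* Main.v *)
Require Import Defs.
From HB Require Import structures.
From mathcomp Require Import all_boot all_order all_algebra.
From mathcomp Require Import all_classical all_reals all_analysis.
From mathcomp Require complex.
From mathcomp Require Import measurable_realfun ring lra.

Import Order.TTheory GRing.Theory Num.Theory.
Import numFieldNormedType.Exports.

Local Open Scope classical_set_scope.
Local Open Scope ring_scope.

(* Le Cam's two-point method.  With [bell h] a smooth compactly supported density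
   of width [h] around [t], compare [f0 = bell h0] with the mixture
   [f1 = (1 - a) f0 + a bell h]: it is a density for every weight [a] in [0, 1],
   and [f1 t - f0 t] is of order [a / h].  Integrating by parts, the Fourier
   transform of [bell h] is bounded by a multiple of [min(1, (|w| h)^(-m))], so
   the perturbation has Sobolev energy of order [a^2 h^(-(2s+1))] and
   [a ~ n^(-1/2)], [h ~ n^(-1/(2s+1))] is allowed.  Privacy enters through the
   laws of one view under [f0] and [bell h], for which the second is at most
   [exp alpha] times the first: the likelihood ratio of one view under [f1] and
   [f0] has second moment at most [1 + a^2 exp alpha], however narrow the bell
   is, and [n] views give at most [exp (n a^2 exp alpha)], which is bounded. *)

Set Implicit Arguments.
Unset Strict Implicit.
Unset Printing Implicit Defensive.

(** * Densities and joint laws *)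

(** The squared gap [(a / h)^2] is of order [n^-1 * n^(2/(2s+1))], which is the claimed rate. The
    data themselves would tell the hypotheses apart: their likelihood ratio has second moment
    [1 + O(a^2 / h)], and the factor [1 / h] would force a smaller [a]. So only the ratio of the
    views may be used. As the space of views is arbitrary, this ratio is a Radon-Nikodym derivative
    with respect to the law of the view under [f0]; the absolute continuity it requires is itself a
    consequence of privacy. The risk is a supremum over probability spaces, so bounding it below
    calls for explicit models: products, over the data holders, of the joint laws of datum and view.
    The change from [f1] to [f0] is then made along the projection to the views, which is why
    integrands factoring through a map recur below. The bell is a truncated power of a parabola,
    flat to an order [m >= s + 1] at its edges, so that the Sobolev weight still leaves an
    integrable tail. *)

Section density.
Local Open Scope ereal_scope.
Context d (E : measurableType d) (R : realType).

Lemma density_measure (m : {measure set E -> \bar R}) (a : E -> \bar R) :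
  (forall x, 0 <= a x) -> measurable_fun [set: E] a ->
  exists nu : {measure set E -> \bar R}, forall A, nu A = \int[m]_(x in A) a x.
Proof.
move=> a0 ma; pose nu A := \int[m]_(x in A) a x.
have nu0 : nu set0 = 0 by exact: integral_set0.
have nu_ge0 A : 0 <= nu A by exact: integral_ge0.
have nu_sigma : semi_sigma_additive nu.
  move=> /= F mF tF mUF; rewrite /nu ge0_integral_bigcup//=; last first.
    exact: measurable_funTS.
  apply: is_cvg_ereal_nneg_natsum_cond => n _ _.
  by apply: integral_ge0 => /= x _.
pose nu' : {measure set E -> \bar R} :=
  HB.pack nu (isMeasure.Build _ _ _ nu nu0 nu_ge0 nu_sigma).
by exists nu'.
Qed.

Lemma finite_measureP (m : {measure set E -> \bar R}) : m setT < +oo ->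
  exists nu : {finite_measure set E -> \bar R}, nu = m :> (set E -> \bar R).
Proof.
move=> mT; have m_fin : fin_num_fun m.
  move=> A mA; rewrite ge0_fin_numE//; apply: le_lt_trans mT.
  by apply: le_measure; rewrite ?inE.
pose f : set E -> \bar R := m.
pose f' : {measure set E -> \bar R} := HB.pack f (isMeasure.Build _ _ _ f
  (measure0 m) (measure_ge0 m) (@measure_semi_sigma_additive _ _ _ m)).
pose fF := Measure_isFinite.Build _ _ _ f' m_fin.
pose nu : {finite_measure set E -> \bar R} := HB.pack (Measure.sort f') fF.
by exists nu.
Qed.

Lemma probability_measureP (m : {measure set E -> \bar R}) : m setT = 1 ->
  exists P : probability E R, P = m :> (set E -> \bar R).
Proof.
move=> mT.
pose f : set E -> \bar R := m.
pose f' : {measure set E -> \bar R} := HB.pack f (isMeasure.Build _ _ _ f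
  (measure0 m) (measure_ge0 m) (@measure_semi_sigma_additive _ _ _ m)).
pose fP := Measure_isProbability.Build _ _ _ f' mT.
pose P : probability E R := HB.pack (Measure.sort f') fP.
by exists P.
Qed.

(** [a] and the Radon-Nikodym derivative of [nu] have the same integral over every measurable set,
    hence agree almost everywhere; the change of variables for the derivative passes to [a]. *)
Lemma integral_density (m : {sigma_finite_measure set E -> \bar R})
    (nu : {finite_measure set E -> \bar R}) (a phi : E -> \bar R) :
  (forall x, 0 <= a x) -> measurable_fun [set: E] a ->
  (forall A, measurable A -> nu A = \int[m]_(x in A) a x) ->
  (forall x, 0 <= phi x) -> measurable_fun [set: E] phi ->
  \int[nu]_x phi x = \int[m]_x (phi x * a x).
Proof.
move=> a0 ma nuE phi0 mphi.
have numu : nu `<< m.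
  apply/null_content_dominatesP => A mA mA0; rewrite nuE//.
  by apply: null_set_integral => //; apply: measurable_funTS.
rewrite -(Radon_Nikodym_SigmaFinite.change_of_variables numu)//.
have mf := measurable_int _ (Radon_Nikodym_SigmaFinite.f_integrable numu).
apply: ae_eq_integral => //.
- exact: emeasurable_funM.
- exact: emeasurable_funM.
- apply: ae_eqe_mul2l; apply: integral_ae_eq => //.
    exact: Radon_Nikodym_SigmaFinite.f_integrable.
  by move=> A _ mA; rewrite -Radon_Nikodym_SigmaFinite.f_integral// nuE.
Qed.

End density.

Section density_preimage.
Local Open Scope ereal_scope.
Context d (E : measurableType d) d' (S : measurableType d') (R : realType).

Lemma integral_preimage_density (m : {sigma_finite_measure set E -> \bar R})
    (p : E -> S) (a : E -> \bar R) :
  measurable_fun [set: E] p ->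
  (forall x, 0 <= a x) -> measurable_fun [set: E] a -> \int[m]_x a x < +oo ->
  exists nu : {measure set S -> \bar R},
    (forall A, nu A = \int[m]_(x in p @^-1` A) a x) /\
    forall phi, (forall x, 0 <= phi x) -> measurable_fun [set: S] phi ->
      \int[m]_x (phi (p x) * a x) = \int[nu]_x phi x.
Proof.
move=> mp a0 ma afin.
have [nu0 nu0E] := density_measure m a0 ma.
have [|nu nuE] := finite_measureP (m := nu0); first by rewrite nu0E.
exists (pushforward nu p); split => [A|phi phi0 mphi].
  by rewrite /= /pushforward nuE nu0E.
rewrite ge0_integral_pushforward// ?preimage_setT.
rewrite (@integral_density _ _ _ m nu a)//.
- by move=> A mA; rewrite nuE nu0E.
- by move=> x; exact: phi0.
- exact: measurableT_comp.
Unshelve. exact: mp.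
Qed.

End density_preimage.

(** The two weighted measures have the same image in [S], and an integrand that factors through [p]
    sees the image only. This is how a weight is traded for a conditional expectation or a
    likelihood ratio. *)
Lemma eq_integral_preimage d (E : measurableType d) d1 (E1 : measurableType d1)
    d' (S : measurableType d') (R : realType)
    (m : {sigma_finite_measure set E -> \bar R})
    (m1 : {sigma_finite_measure set E1 -> \bar R})
    (p : E -> S) (p1 : E1 -> S)
    (a : E -> \bar R) (a1 : E1 -> \bar R) (phi : S -> \bar R) :
  measurable_fun [set: E] p -> measurable_fun [set: E1] p1 ->
  (forall x, 0 <= a x)%E -> measurable_fun [set: E] a ->
  (forall x, 0 <= a1 x)%E -> measurable_fun [set: E1] a1 ->
  (\int[m]_x a x < +oo)%E ->
  (forall A, measurable A ->
     (\int[m]_(x in p @^-1` A) a x = \int[m1]_(x in p1 @^-1` A) a1 x)%E) ->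
  (forall x, 0 <= phi x)%E -> measurable_fun [set: S] phi ->
  (\int[m]_x (phi (p x) * a x) = \int[m1]_x (phi (p1 x) * a1 x))%E.
Proof.
move=> mp mp1 a0 ma a10 ma1 afin aa1 phi0 mphi.
have [nu [nuE nuI]] := integral_preimage_density mp a0 ma afin.
have a1fin : (\int[m1]_x a1 x < +oo)%E.
  by have := aa1 setT measurableT; rewrite !preimage_setT => <-.
have [nu1 [nu1E nu1I]] := integral_preimage_density mp1 a10 ma1 a1fin.
rewrite nuI// nu1I//; apply: eq_measure_integral => A mA _; by rewrite nuE nu1E aa1.
Qed.

Section kernel_joint_law.
Local Open Scope ereal_scope.
Context d (S : measurableType d) d' (T : measurableType d') (R : realType).

(** The law of a datum and its view: a set is measured by averaging the [Q x]-mass of its section at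
    [x], and countable additivity is monotone convergence. *)
Lemma kernel_joint_law (m : probability S R) (Q : R.-pker S ~> T) :
  exists nu : probability (S * T)%type R,
    forall A B, measurable A -> measurable B ->
      nu (A `*` B) = \int[m]_(x in A) Q x B.
Proof.
pose nu C := \int[m]_x Q x (xsection C x).
have mQ C : measurable C -> measurable_fun [set: S] (fun x => Q x (xsection C x)).
  move=> mC; have [l Ql] := measure_uub Q.
  apply: measurable_fun_xsection_finite_kernel; rewrite ?inE//.
have nu0 : nu set0 = 0.
  by apply: integral0_eq => x _; rewrite xsection0 measure0.
have nu_ge0 C : 0 <= nu C by apply: integral_ge0.
have nu_sigma : semi_sigma_additive nu.
  move=> F mF tF mUF; rewrite [X in _ --> X](_ : _ =
      \int[m]_x (\sum_(n <oo) Q x (xsection (F n) x))); last first.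
    apply: eq_integral => x _; apply/esym/cvg_lim => //; rewrite xsection_bigcup.
    apply: measure_semi_sigma_additive.
    - by move=> n; exact: measurable_xsection.
    - exact: trivIset_xsection.
    - by apply: bigcup_measurable => n _; exact: measurable_xsection.
  apply/cvg_closeP; split.
    by apply: is_cvg_nneseries => n _ _; exact: integral_ge0.
  by rewrite closeE// integral_nneseries// => n; exact: mQ.
pose nu' : {measure set (S * T) -> \bar R} :=
  HB.pack nu (isMeasure.Build _ _ _ nu nu0 nu_ge0 nu_sigma).
have [|P PE] := @probability_measureP _ _ _ nu'.
  rewrite /= /nu; under eq_integral do rewrite xsectionE preimage_setT prob_kernel.
  by rewrite integral_cst//= probability_setT mule1.
exists P => A B mA mB; rewrite PE /= /nu [RHS]integral_mkcond.
apply: eq_integral => x _; rewrite patchE; case: ifPn => xA.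
  by rewrite in_xsectionX.
by rewrite notin_xsectionX// measure0.
Qed.

End kernel_joint_law.

(** * Products of laws on tuples *)

Section tuple_law.
Context d (E : measurableType d) (R : realType).

Definition tcons n (z : E * n.-tuple E) : n.+1.-tuple E :=
  [the n.+1.-tuple E of z.1 :: z.2].

Lemma measurable_tcons n : measurable_fun [set: E * n.-tuple E] (@tcons n).
Proof. exact: measurable_cons. Qed.

HB.instance Definition _ n :=
  isMeasurableFun.Build _ _ _ _ (@tcons n) (@measurable_tcons n).

(** One law per coordinate, since the data holders may use different mechanisms; the recursion lets
    integrals be computed one coordinate at a time. *)
Fixpoint tuple_law n : ('I_n -> probability E R) -> probability (n.-tuple E) R :=
  match n with
  | 0 => fun _ => dirac [tuple]
  | n.+1 => fun nu =>
      distribution (nu ord0 \x tuple_law (fun i => nu (lift ord0 i)))%E (@tcons n)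
  end.

Local Open Scope ereal_scope.

Lemma integral_tuple_law0 (nu : 'I_0 -> probability E R) (g : 0.-tuple E -> \bar R) :
  (forall w, 0 <= g w) -> measurable_fun [set: 0.-tuple E] g ->
  \int[tuple_law nu]_w g w = g [tuple].
Proof. by move=> g0 mg; rewrite integral_dirac//= diracT mul1e. Qed.

Lemma integral_tuple_lawS n (nu : 'I_n.+1 -> probability E R)
    (g : n.+1.-tuple E -> \bar R) :
  (forall w, 0 <= g w) -> measurable_fun [set: n.+1.-tuple E] g ->
  \int[tuple_law nu]_w g w =
  \int[nu ord0]_e \int[tuple_law (fun i => nu (lift ord0 i))]_w g (tcons (e, w)).
Proof.
move=> g0 mg; rewrite ge0_integral_distribution//= fubini_tonelli1//.
exact: measurableT_comp.
Qed.

End tuple_law.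

Section tensorization.
Context d (E : measurableType d) d' (S : measurableType d') (R : realType).
Local Open Scope ereal_scope.

Lemma measurable_map_tuple n (p : E -> S) : measurable_fun [set: E] p ->
  measurable_fun [set: n.-tuple E] (map_tuple p : n.-tuple E -> n.-tuple S).
Proof.
move=> mp; apply/measurable_fun_tnthP => i.
rewrite (_ : _ \o _ = p \o (@tnth _ _ ^~ i)); last first.
  by apply/funext => w /=; rewrite tnth_map.
by apply: measurableT_comp => //; exact: measurable_tnth.
Qed.

Lemma measurable_prod_tnth n (a : 'I_n -> E -> \bar R) :
  (forall i, measurable_fun [set: E] (a i)) ->
  measurable_fun [set: n.-tuple E] (fun w => \prod_(i < n) a i (tnth w i)).
Proof.
move=> ma; elim: (index_enum _) => [|i r IHr].
  by under eq_fun do rewrite big_nil; exact: measurable_cst.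
under eq_fun do rewrite big_cons; apply: emeasurable_funM => //.
by apply: measurableT_comp => //; exact: measurable_tnth.
Qed.

(** Weights may be exchanged coordinate by coordinate, by induction and Tonelli. It serves with [p]
    constant for integrals of products, with [p = fst] for conditioning on the data, and with
    [p = snd] for the change of measure on the views. *)
Lemma integral_tuple_law_tensor n (nu nu1 : 'I_n -> probability E R) (p : E -> S)
    (a a1 : 'I_n -> E -> \bar R) (G : n.-tuple S -> \bar R) :
  measurable_fun [set: E] p ->
  (forall i x, 0 <= a i x) -> (forall i, measurable_fun [set: E] (a i)) ->
  (forall i x, 0 <= a1 i x) -> (forall i, measurable_fun [set: E] (a1 i)) ->
  (forall i phi, (forall y, 0 <= phi y) -> measurable_fun [set: S] phi ->
    \int[nu i]_x (phi (p x) * a i x) = \int[nu1 i]_x (phi (p x) * a1 i x)) ->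
  (forall y, 0 <= G y) -> measurable_fun [set: n.-tuple S] G ->
  \int[tuple_law nu]_w (G (map_tuple p w) * \prod_(i < n) a i (tnth w i)) =
  \int[tuple_law nu1]_w (G (map_tuple p w) * \prod_(i < n) a1 i (tnth w i)).
Proof.
move=> mp.
have mGw k (F : k.-tuple S -> \bar R) (b : 'I_k -> E -> \bar R) :
    measurable_fun [set: k.-tuple S] F -> (forall i, measurable_fun [set: E] (b i)) ->
    measurable_fun [set: k.-tuple E]
      (fun w => F (map_tuple p w) * \prod_(i < k) b i (tnth w i)).
  move=> mF mb; apply: emeasurable_funM; last exact: measurable_prod_tnth.
  by apply: measurableT_comp mF _; exact: measurable_map_tuple.
have Gw0 k (F : k.-tuple S -> \bar R) (b : 'I_k -> E -> \bar R) w :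
    (forall y, 0 <= F y) -> (forall i x, 0 <= b i x) ->
    0 <= F (map_tuple p w) * \prod_(i < k) b i (tnth w i).
  by move=> F0 b0; apply: mule_ge0 => //; apply: prode_ge0.
elim: n nu nu1 a a1 G => [|n IHn] nu nu1 a a1 G a0 ma a10 ma1 aa1 G0 mG.
  rewrite !integral_tuple_law0 ?big_ord0//; try (by move=> w; exact: Gw0);
    exact: mGw.
rewrite !integral_tuple_lawS; [|by move=> w; exact: Gw0|exact: mGw
  |by move=> w; exact: Gw0|exact: mGw].
(* What remains once all coordinates but the first are integrated out; it depends on the first one
   only through its image [s], so the hypothesis on a single coordinate applies to it. *)
pose H s := \int[tuple_law (fun i => nu1 (lift ord0 i))]_w
  (G (tcons (s, map_tuple p w)) * \prod_(i < n) a1 (lift ord0 i) (tnth w i)).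
have mGs s : measurable_fun [set: n.-tuple S] (fun y => G (tcons (s, y))).
  apply: (measurableT_comp mG (g := fun y => tcons (s, y))).
  exact: (measurable_cons (f := fun=> s) (g := id)).
have mH : measurable_fun [set: S] H.
  apply: (measurable_fun_fubini_tonelli_F
    (fun z : S * n.-tuple E => G (tcons (z.1, map_tuple p z.2)) *
      \prod_(i < n) a1 (lift ord0 i) (tnth z.2 i))) => /=.
    apply: emeasurable_funM.
      apply: measurableT_comp mG _.
      apply: (measurable_cons (f := fst) (g := fun z => map_tuple p z.2)) => //.
      by apply: (measurableT_comp (@measurable_map_tuple _ p mp)).
    have := @measurable_prod_tnth n (fun i => a1 (lift ord0 i)) (fun i => ma1 _).
    by move=> /measurableT_comp; apply.
  by move=> z; apply: mule_ge0 => //; apply: prode_ge0.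
have H0 s : 0 <= H s.
  by apply: integral_ge0 => w _; apply: mule_ge0 => //; apply: prode_ge0.
have step (m : 'I_n.+1 -> probability E R) (b : 'I_n.+1 -> E -> \bar R) :
    (forall i x, 0 <= b i x) -> (forall i, measurable_fun [set: E] (b i)) ->
    (forall s, \int[tuple_law (fun i => m (lift ord0 i))]_w
      (G (tcons (s, map_tuple p w)) *
       \prod_(i < n) b (lift ord0 i) (tnth w i)) = H s) ->
    \int[m ord0]_e \int[tuple_law (fun i => m (lift ord0 i))]_w
      (G (map_tuple p (tcons (e, w))) * \prod_(i < n.+1) b i (tnth (tcons (e, w)) i)) =
    \int[m ord0]_e (H (p e) * b ord0 e).
  move=> b0 mb bH; apply: eq_integral => e _; rewrite muleC -bH -ge0_integralZl//.
  - apply: eq_integral => w _; rewrite big_ord_recl muleCA; congr (_ * _).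
    congr (_ * _); first by congr G; exact/val_inj.
    by apply: eq_bigr => i _; rewrite (tnthS e).
  - exact: (mGw _ (fun y => G (tcons (p e, y))) (fun i => b (lift ord0 i))).
  - by move=> w _; apply: mule_ge0 => //; apply: prode_ge0.
rewrite !step//; first exact: (aa1 ord0 H).
move=> s; apply: (IHn _ _ (fun i => a (lift ord0 i)) (fun i => a1 (lift ord0 i))
  (fun y => G (tcons (s, y)))) => // i; exact: aa1.
Qed.

End tensorization.

(** * Likelihood ratios *)

Section likelihood_ratio.
Context d (T : measurableType d) (R : realType).

(** With [sigma] the density of [nu2], the second moment is the integral of [sigma] against [nu2];
    domination bounds it by [c] times the integral of [sigma] against [nu0], which is 1. *)
Lemma dominated_likelihood_ratio (nu0 nu2 : probability T R) (c : R) : 0 <= c ->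
  (forall B, measurable B -> nu2 B <= c%:E * nu0 B)%E ->
  exists sigma : T -> R, [/\ forall z, 0 <= sigma z,
    measurable_fun [set: T] sigma,
    forall B, measurable B -> nu2 B = (\int[nu0]_(z in B) (sigma z)%:E)%E
  & (\int[nu0]_z (sigma z ^+ 2)%:E <= c%:E)%E].
Proof.
move=> c0 nu20.
have nu2_dom : nu2 `<< nu0.
  apply/null_content_dominatesP => A mA A0; apply/eqP.
  by rewrite eq_le measure_ge0 andbT (le_trans (nu20 _ mA))// A0 mule0.
pose f := Radon_Nikodym_SigmaFinite.f nu2 nu0.
have f0 x : (0 <= f x)%E by exact: Radon_Nikodym_SigmaFinite.f_ge0.
have ffin x : f x \is a fin_num by exact: Radon_Nikodym_SigmaFinite.f_fin_num.
have mf : measurable_fun [set: T] f.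
  exact: measurable_int (Radon_Nikodym_SigmaFinite.f_integrable _).
have fE x : (fine (f x))%:E = f x by rewrite fineK.
have nu2E B : measurable B -> nu2 B = (\int[nu0]_(z in B) f z)%E.
  by move=> mB; rewrite -Radon_Nikodym_SigmaFinite.f_integral.
exists (fine \o f); split => [x|||].
- by rewrite fine_ge0.
- exact: measurableT_comp.
- by move=> B mB; rewrite nu2E//; apply: eq_integral => x _; rewrite /= fE.
under eq_integral do rewrite /= expr2 EFinM !fE.
rewrite Radon_Nikodym_SigmaFinite.change_of_variables//.
apply: (@le_trans _ _ (\int[mscale (NngNum c0) nu0]_z f z)%E).
  by apply: ge0_le_measure_integral => // B mB; exact: nu20.
rewrite ge0_integral_mscale//= -nu2E// probability_setT mule1//.
Qed.

(** The ratio is [(1 - a) + a * sigma] with [sigma] of mean 1, so the terms linear in [a] cancel: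
    [(1 - a)^2 + 2 a (1 - a) + a^2 c = 1 - a^2 + a^2 c]. The order [a^2] is what permits [a] of
    order [n^(-1/2)]. *)
Lemma mixture_likelihood_ratio (nu0 nu1 nu2 : probability T R) (a c : R) :
  0 <= a <= 1 -> 0 <= c ->
  (forall B, measurable B -> nu2 B <= c%:E * nu0 B)%E ->
  (forall B, measurable B -> nu1 B = (1 - a)%:E * nu0 B + a%:E * nu2 B)%E ->
  exists rho : T -> R, [/\ forall z, 0 <= rho z,
    measurable_fun [set: T] rho,
    forall B, measurable B -> nu1 B = (\int[nu0]_(z in B) (rho z)%:E)%E
  & (\int[nu0]_z (rho z ^+ 2)%:E <= (1 + a ^+ 2 * c)%:E)%E].
Proof.
move=> /andP[a0 a1] c0 nu20 nu1E.
have [sigma [s0 ms nu2E s2]] := dominated_likelihood_ratio c0 nu20.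
have a1' : 0 <= 1 - a by rewrite subr_ge0.
exists (fun z => (1 - a) + a * sigma z); split => [z|||].
- by rewrite addr_ge0// mulr_ge0.
- by apply: measurable_funD => //; exact: measurable_funM.
- move=> B mB; under eq_integral do rewrite EFinD EFinM.
  have msB := measurable_funTS (D := B) ms.
  rewrite ge0_integralD//; [|by move=> z _; rewrite -EFinM lee_fin mulr_ge0
    |exact/measurable_funeM/measurable_EFinP].
  rewrite integral_cst// nu1E// ge0_integralZl//;
    [|exact/measurable_EFinP|by move=> z _; rewrite lee_fin].
  by rewrite nu2E.
have -> : (\int[nu0]_z ((1 - a + a * sigma z) ^+ 2)%:E =
   \int[nu0]_z ((((1 - a) ^+ 2)%:E + (2 * a * (1 - a))%:E * (sigma z)%:E) +
     (a ^+ 2)%:E * (sigma z ^+ 2)%:E))%E.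
  by apply: eq_integral => z _; rewrite -!EFinM -!EFinD; congr EFin; ring.
have ms2 : measurable_fun [set: T] (fun z => sigma z ^+ 2) by exact: measurable_funX.
have b0 : 0 <= 2 * a * (1 - a) by rewrite !mulr_ge0.
rewrite ge0_integralD//=;
  [|by move=> z _; rewrite -EFinM -EFinD lee_fin addr_ge0 ?mulr_ge0 ?sqr_ge0
  |apply: emeasurable_funD => //; exact/measurable_funeM/measurable_EFinP
  |by move=> z _; rewrite -EFinM lee_fin mulr_ge0 ?sqr_ge0
  |exact/measurable_funeM/measurable_EFinP].
rewrite ge0_integralD//=; [|by move=> z _; rewrite lee_fin sqr_ge0
  |by move=> z _; rewrite -EFinM lee_fin mulr_ge0
  |exact/measurable_funeM/measurable_EFinP].
rewrite integral_cst//= ge0_integralZl//; [|exact/measurable_EFinP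
  |by move=> z _; rewrite lee_fin].
rewrite ge0_integralZl//; [|exact/measurable_EFinP
  |by move=> z _; rewrite lee_fin sqr_ge0|by rewrite lee_fin sqr_ge0].
rewrite -nu2E// !probability_setT !mule1.
apply: (@le_trans _ _ (((1 - a) ^+ 2)%:E + (2 * a * (1 - a))%:E + (a ^+ 2 * c)%:E)%E).
  by rewrite leeD2l// [leRHS]EFinM lee_wpmul2l// lee_fin sqr_ge0.
by rewrite -!EFinD lee_fin lerD2r; nra.
Qed.

(* Writing e_i for the error [l - theta_i], AM-GM gives the pointwise bound
   [D^2 rho <= D^2 (rho^2 / (4 M) + rho / 4) + M e_0^2 + e_1^2 rho]
   where [D = theta1 - theta0]; it is then integrated. *)
Lemma two_point_bound d' (W : measurableType d') (P : probability W R)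
    (l rho : W -> R) (M theta0 theta1 : R) (r : \bar R) :
  1 <= M -> measurable_fun [set: W] l -> measurable_fun [set: W] rho ->
  (forall w, 0 <= rho w) ->
  (\int[P]_w (rho w)%:E = 1)%E -> (\int[P]_w (rho w ^+ 2)%:E <= M%:E)%E ->
  (\int[P]_w ((l w - theta0) ^+ 2)%:E <= r)%E ->
  (\int[P]_w ((l w - theta1) ^+ 2 * rho w)%:E <= r)%E ->
  (((theta1 - theta0) ^+ 2 / (2 * (M + 1)))%:E <= r)%E.
Proof.
move=> M1 ml mrho rho0 Irho Irho2 r0 r1.
have rge0 : (0 <= r)%E.
  by apply: le_trans r0; apply: integral_ge0 => w _; rewrite lee_fin sqr_ge0.
case: r rge0 r0 r1 => [r||] rge0 r0 r1; [|by rewrite leey|by []].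
set D := theta1 - theta0.
have me0 : measurable_fun [set: W] (fun w => (l w - theta0) ^+ 2).
  by apply: measurable_funX; exact: measurable_funB.
have me1 : measurable_fun [set: W] (fun w => (l w - theta1) ^+ 2 * rho w).
  by apply: measurable_funM => //; apply: measurable_funX; exact: measurable_funB.
have mrho2 : measurable_fun [set: W] (fun w => rho w ^+ 2) by exact: measurable_funX.
have M0 : 0 < M by exact: lt_le_trans M1.
have c20 : 0 <= D ^+ 2 / (4 * M) by rewrite divr_ge0 ?sqr_ge0// mulr_ge0// ltW.
have c10 : 0 <= D ^+ 2 / 4 by rewrite divr_ge0 ?sqr_ge0.
have : (\int[P]_w ((D ^+ 2)%:E * (rho w)%:E) <=
    \int[P]_w ((((D ^+ 2 / (4 * M))%:E * (rho w ^+ 2)%:E +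
              (D ^+ 2 / 4)%:E * (rho w)%:E) + M%:E * ((l w - theta0) ^+ 2)%:E) +
              ((l w - theta1) ^+ 2 * rho w)%:E))%E.
  apply: ge0_le_integral => //.
  - by move=> w _; rewrite -EFinM lee_fin mulr_ge0 ?sqr_ge0.
  - exact/measurable_funeM/measurable_EFinP.
  - by repeat apply: emeasurable_funD; try apply: measurable_funeM;
       exact/measurable_EFinP.
  - move=> w _; rewrite -!EFinM -!EFinD lee_fin.
    have := rho0 w; set x := rho w; set y := l w => x0.
    have DE : D = (y - theta0) - (y - theta1) by rewrite /D; ring.
    have h1 : D ^+ 2 / (4 * M) * x ^+ 2 + M * (y - theta0) ^+ 2 - D * x * (y - theta0) =
        (D * x / 2 - M * (y - theta0)) ^+ 2 / M by field; rewrite ?gt_eqF.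
    have h2 : D ^+ 2 / 4 * x + (y - theta1) ^+ 2 * x + D * x * (y - theta1) =
        (D / 2 + (y - theta1)) ^+ 2 * x by field.
    have h3 : 0 <= (D * x / 2 - M * (y - theta0)) ^+ 2 / M.
      by rewrite divr_ge0 ?sqr_ge0// ltW.
    have h4 : 0 <= (D / 2 + (y - theta1)) ^+ 2 * x by rewrite mulr_ge0 ?sqr_ge0.
    rewrite -h1 in h3; rewrite -h2 in h4.
    have h5 : D ^+ 2 * x = D * x * (y - theta0) - D * x * (y - theta1).
      by rewrite /D; ring.
    lra.
have pos0 w : (0 <= (D ^+ 2 / (4 * M))%:E * (rho w ^+ 2)%:E)%E.
  by rewrite -EFinM lee_fin mulr_ge0 ?sqr_ge0.
have pos1 w : (0 <= (D ^+ 2 / 4)%:E * (rho w)%:E)%E.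
  by rewrite -EFinM lee_fin mulr_ge0 ?sqr_ge0.
have pos2 w : (0 <= M%:E * ((l w - theta0) ^+ 2)%:E)%E.
  by rewrite -EFinM lee_fin mulr_ge0 ?sqr_ge0// ltW.
have pos3 w : (0 <= ((l w - theta1) ^+ 2 * rho w)%:E)%E.
  by rewrite lee_fin mulr_ge0 ?sqr_ge0.
have m0 : measurable_fun [set: W] (fun w => (D ^+ 2 / (4 * M))%:E * (rho w ^+ 2)%:E)%E.
  exact/measurable_funeM/measurable_EFinP.
have m1 : measurable_fun [set: W] (fun w => (D ^+ 2 / 4)%:E * (rho w)%:E)%E.
  exact/measurable_funeM/measurable_EFinP.
have m2 : measurable_fun [set: W] (fun w => M%:E * ((l w - theta0) ^+ 2)%:E)%E.
  exact/measurable_funeM/measurable_EFinP.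
rewrite ge0_integralZl//; [|exact/measurable_EFinP|by move=> w _; rewrite lee_fin
  |by rewrite lee_fin sqr_ge0].
rewrite Irho mule1.
rewrite ge0_integralD//; [|by move=> w _; rewrite !adde_ge0
  |by repeat apply: emeasurable_funD|exact/measurable_EFinP].
rewrite ge0_integralD//; [|by move=> w _; rewrite adde_ge0|exact: emeasurable_funD].
rewrite ge0_integralD// !ge0_integralZl//; [|exact/measurable_EFinP
  |by move=> w _; rewrite lee_fin sqr_ge0|by rewrite lee_fin ltW
  |exact/measurable_EFinP|by move=> w _; rewrite lee_fin|exact/measurable_EFinP
  |by move=> w _; rewrite lee_fin sqr_ge0].
rewrite Irho mule1 => h.
have : ((D ^+ 2)%:E <= (D ^+ 2 / (4 * M) * M + D ^+ 2 / 4 + M * r + r)%:E)%E.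
  apply: (le_trans h); rewrite !EFinD.
  apply: leeD => //; apply: leeD; last first.
    by rewrite [leRHS]EFinM lee_wpmul2l// lee_fin ltW.
  by apply: leeD => //; rewrite [leRHS]EFinM lee_wpmul2l.
rewrite !lee_fin.
(* Two quarters of [D^2] are absorbed on the left, which leaves half of [D^2] below
   [(M + 1) * r]. *)
have -> : D ^+ 2 / (4 * M) * M = D ^+ 2 / 4 by field; rewrite gt_eqF.
by rewrite ler_pdivrMr; nra.
Qed.

End likelihood_ratio.

(** Tensorization along the constant map to [unit]: each weight is traded for the constant equal to
    its integral. *)
Lemma integral_tuple_law_prod d (E : measurableType d) (R : realType) n
    (nu : 'I_n -> probability E R) (a : 'I_n -> E -> \bar R) :
  (forall i x, 0 <= a i x)%E -> (forall i, measurable_fun [set: E] (a i)) ->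
  (\int[tuple_law nu]_w \prod_(i < n) a i (tnth w i) =
   \prod_(i < n) \int[nu i]_x a i x)%E.
Proof.
move=> a0 ma; pose I i := (\int[nu i]_x a i x)%E.
have I0 i : (0 <= I i)%E by apply: integral_ge0.
have tensor := @integral_tuple_law_tensor _ E _ unit R n nu nu (fun=> tt) a
  (fun i => cst (I i)) (cst 1%E).
transitivity (\int[tuple_law nu]_w (1 * \prod_(i < n) a i (tnth w i)))%E.
  by apply: eq_integral => w _; rewrite mul1e.
rewrite {}tensor//=.
  by rewrite integral_cst//= probability_setT mul1e mule1.
move=> i phi phi0 _; rewrite [RHS]integral_cst//= probability_setT mule1.
by rewrite ge0_integralZl.
Qed.

Lemma prod_indicE (T : Type) (R : realType) n (B : 'I_n -> set T) (w : 'I_n -> T) :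
  (\prod_(i < n) (\1_(B i) (w i))%:E)%E =
  (\1_[set w : 'I_n -> T | forall i, B i (w i)] w)%:E :> \bar R.
Proof.
rewrite indicE; have [/set_mem/= Bw|] := boolP (_ \in _).
  by rewrite big1// => i _; rewrite indicE mem_set.
rewrite notin_setE/= => /existsNP[i Bi].
by rewrite (bigD1 i)//= indicE memNset// mul0e.
Qed.

(** * The joint law of a datum and its view *)

Section joint_law.
Context d (S : measurableType d) d' (T : measurableType d') (R : realType).
Variables (m : probability S R) (Q : R.-pker S ~> T).
Variable nu : probability (S * T)%type R.
Hypothesis nuE : forall A B, measurable A -> measurable B ->
  (nu (A `*` B) = \int[m]_(x in A) Q x B)%E.
Local Open Scope ereal_scope.

Lemma joint_law_fst A : measurable A -> nu (fst @^-1` A) = m A.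
Proof.
move=> mA; rewrite -[_ @^-1` _]setXT nuE//.
by under eq_integral do rewrite prob_kernel; rewrite integral_cst// mul1e.
Qed.

Lemma joint_law_snd B : measurable B -> nu (snd @^-1` B) = \int[m]_x Q x B.
Proof. by move=> mB; rewrite -[_ @^-1` _]setTX nuE. Qed.

Lemma integral_joint_law_fst (A : set S) (g : S -> \bar R) : measurable A ->
  (forall x, 0 <= g x) -> measurable_fun [set: S] g ->
  \int[nu]_(z in fst @^-1` A) g z.1 = \int[m]_(x in A) g x.
Proof.
move=> mA g0 mg.
rewrite -(@ge0_integral_pushforward _ _ _ _ R fst measurable_fst nu A g)//; last first.
  exact: measurable_funTS.
apply: eq_measure_integral => B mB _; exact: joint_law_fst.
Qed.

(** [Q z.1 B] is the conditional probability of [z.2] lying in [B] given the datum: both weights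
    have the same integral over every event on the first coordinate. *)
Lemma integral_joint_law_kernel (B : set T) (phi : S -> \bar R) : measurable B ->
  (forall x, 0 <= phi x) -> measurable_fun [set: S] phi ->
  \int[nu]_z (phi z.1 * (\1_B z.2)%:E) = \int[nu]_z (phi z.1 * Q z.1 B).
Proof.
move=> mB phi0 mphi.
have mQ : measurable_fun [set: S] (Q ^~ B) by exact: measurable_kernel.
have mB2 : measurable (snd @^-1` B : set (S * T)).
  by rewrite -setTX; exact: measurableX.
have m1 : measurable_fun [set: S * T] (fun z => (\1_B z.2)%:E : \bar R).
  apply/measurable_EFinP; exact: (@measurable_indic _ _ R setT (snd @^-1` B)).
apply: (@eq_integral_preimage _ _ _ _ _ _ _ _ _ fst fst
  (fun z => (\1_B z.2)%:E) (fun z => Q z.1 B)) => //.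
- exact: (measurableT_comp mQ).
- rewrite (_ : \int[_]_x _ = nu (snd @^-1` B)).
    by rewrite (le_lt_trans (probability_le1 _ _))// ltry.
  by have := integral_indic nu measurableT mB2; rewrite setIT.
- move=> A mA; rewrite (@integral_joint_law_fst A (Q ^~ B))//.
  rewrite -nuE// -[LHS]/(\int[nu]_(z in fst @^-1` A) (\1_(snd @^-1` B) z)%:E).
  rewrite integral_indic//; last by rewrite -setXT; exact: measurableX.
  by rewrite setIC; congr (nu _); apply/seteqP; split=> -[].
Qed.

End joint_law.

(** * Non-interactive private models *)

(* [R] carries two copies of the Borel sigma-algebra that differ by their display:
   [lebesgue_measure] lives on [measurableTypeR R], data and kernels on [R]; the
   law below is transported from the former to the latter by the identity. *)
Lemma probability_density_law (R : realType) (f : R -> R) :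
  probability_density f ->
  exists m : probability R R,
    (forall A, m A = \int[@lebesgue_measure R]_(x in A) (f x)%:E)%E /\
    forall g : R -> \bar R, (forall x, 0 <= g x)%E -> measurable_fun [set: R] g ->
      (\int[m]_x g x = \int[@lebesgue_measure R]_x (g x * (f x)%:E))%E.
Proof.
move=> [mf f0 f1].
have f0' x : (0 <= (EFin \o f) x)%E by rewrite lee_fin.
have mf' : measurable_fun [set: measurableTypeR R] (EFin \o f).
  exact/measurable_EFinP.
have [m mE] := density_measure lebesgue_measure f0' mf'.
have [|P PE] := probability_measureP (m := m); first by rewrite mE.
have mid : measurable_fun [set: measurableTypeR R] (id : _ -> R).
  by move=> _ A mA; rewrite setTI.
pose idR : {mfun measurableTypeR R >-> R} :=
  HB.pack (id : measurableTypeR R -> R) (isMeasurableFun.Build _ _ _ _ _ mid).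
exists (distribution P idR); split => [A|g g0 mg].
  by rewrite -mE -PE.
rewrite ge0_integral_distribution//.
rewrite (@integral_density _ _ _ lebesgue_measure P (EFin \o f))//.
by move=> A mA; rewrite -mE -PE.
Qed.

Section private_model.
Context (R : realType) d (T : measurableType d) (n : nat).
Variable Q : 'I_n -> R.-pker R ~> T.

Definition model_data (i : 'I_n) (w : n.-tuple (R * T)) : R := (tnth w i).1.
Definition model_view (i : 'I_n) (w : n.-tuple (R * T)) : T := (tnth w i).2.

Lemma measurable_model_data i : measurable_fun [set: n.-tuple (R * T)] (model_data i).
Proof. by apply: measurableT_comp measurable_fst _; exact: measurable_tnth. Qed.

Lemma measurable_model_view i : measurable_fun [set: n.-tuple (R * T)] (model_view i).
Proof. by apply: measurableT_comp measurable_snd _; exact: measurable_tnth. Qed.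

HB.instance Definition _ i :=
  isMeasurableFun.Build _ _ _ _ (model_data i) (@measurable_model_data i).
HB.instance Definition _ i :=
  isMeasurableFun.Build _ _ _ _ (model_view i) (@measurable_model_view i).

Local Notation mu := (@lebesgue_measure R).

Variables (f : R -> R) (m : probability R R) (nu : 'I_n -> probability (R * T)%type R).
Hypothesis mE : forall A, m A = (\int[mu]_(x in A) (f x)%:E)%E.
Hypothesis nuE : forall i A B, measurable A -> measurable B ->
  (nu i (A `*` B) = \int[m]_(x in A) Q i x B)%E.

Lemma tuple_law_box d' (E : measurableType d') (nu' : 'I_n -> probability E R)
    (C : 'I_n -> set E) : (forall i, measurable (C i)) ->
  (tuple_law nu' [set w | forall i, C i (tnth w i)] = \prod_(i < n) nu' i (C i))%E.
Proof.
move=> mC.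
have mbox : measurable [set w : n.-tuple E | forall i, C i (tnth w i)].
  rewrite [X in measurable X](_ : _ = \bigcap_(i : 'I_n) (@tnth n E ^~ i @^-1` C i)).
    apply: fin_bigcap_measurable => // i _; rewrite -[X in measurable X]setTI.
    exact: measurable_tnth.
  by apply/seteqP; split => w /= wC i; [move=> _|]; exact: wC.
have := integral_indic (tuple_law nu') measurableT mbox; rewrite setIT => <-.
transitivity (\int[tuple_law nu']_w \prod_(i < n) (\1_(C i) (tnth w i))%:E)%E.
  by apply: eq_integral => w _; rewrite (prod_indicE R C (tnth w)).
rewrite (@integral_tuple_law_prod _ E R n nu' (fun i x => (\1_(C i) x)%:E)).
- by apply: eq_bigr => i _; rewrite integral_indic// setIT.
- by move=> i x; rewrite lee_fin.
- by move=> i; exact/measurable_EFinP.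
Qed.

Lemma model_iid : iid_density f (P := tuple_law nu) model_data.
Proof.
move=> A mA; under eq_bigr do rewrite -mE.
rewrite (tuple_law_box nu (C := fun i => fst @^-1` A i)).
  by apply: eq_bigr => i _; rewrite (joint_law_fst (nuE i)).
by move=> i; rewrite -[X in measurable X]setTI; exact: measurable_fst.
Qed.

(** Tensorization along [fst], with the indicator of [A] as the function of the data: in each
    coordinate the indicator of [B i] is traded for its conditional probability. This reaches sets
    [A] that are not boxes. *)
Lemma model_noninteractive :
  noninteractive_views Q (P := tuple_law nu) model_data model_view.
Proof.
move=> A B mA mB.
have mapE (w : n.-tuple (R * T)) : [tuple model_data i w | i < n] = map_tuple fst w.
  by apply/eq_from_tnth => i; rewrite tnth_mktuple tnth_map.
have mX : measurable_fun [set: n.-tuple (R * T)]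
    (map_tuple fst : n.-tuple (R * T) -> n.-tuple R).
  by apply: measurable_map_tuple.
have mAX : measurable [set w : n.-tuple (R * T) | A [tuple model_data i w | i < n]].
  under eq_set do rewrite mapE.
  by rewrite -[X in measurable X]setTI; exact: mX.
have mBZ : measurable [set w : n.-tuple (R * T) | forall i, B i (model_view i w)].
  rewrite [X in measurable X](_ : _ = \bigcap_(i : 'I_n) (model_view i @^-1` B i)).
    apply: fin_bigcap_measurable => // i _; rewrite -[X in measurable X]setTI.
    exact: measurable_model_view.
  by apply/seteqP; split => w /= wC i; [move=> _|]; exact: wC.
pose G (y : n.-tuple R) : \bar R := (\1_A y)%:E.
have mG : measurable_fun [set: n.-tuple R] G by exact/measurable_EFinP.
have := @integral_tuple_law_tensor _ (R * T)%type _ R R n nu nu fst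
  (fun i z => (\1_(B i) z.2)%:E) (fun i z => Q i z.1 (B i)) G.
move=> tensor.
transitivity (\int[tuple_law nu]_w (G (map_tuple fst w) *
    \prod_(i < n) (\1_(B i) (tnth w i).2)%:E))%E.
  have := integral_indic (tuple_law nu) measurableT (measurableI _ _ mAX mBZ).
  rewrite setIT => <-.
  apply: eq_integral => w _.
  rewrite (prod_indicE R B (fun i => (tnth w i).2)) -EFinM indicI /=.
  by congr (_ * _)%:E; rewrite -?mapE !indicE; congr (nat_of_bool _)%:R;
    apply/idP/idP; rewrite !inE.
rewrite tensor//=.
- rewrite [RHS]integral_mkcond/=; apply: eq_integral => w _; rewrite patchE.
  rewrite /G indicE -mapE.
  have [Aw|Aw] := boolP ([tuple model_data i w | i < n] \in A).
    by rewrite mul1e mem_set//; move: Aw; rewrite inE.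
  by rewrite mul0e memNset//; move: Aw; rewrite notin_setE.
- move=> i; apply/measurable_EFinP.
  exact: (measurableT_comp (measurable_indic (mB i)) measurable_snd).
- by move=> i; apply: measurableT_comp (measurable_kernel (Q i) _ (mB i)) _.
- by move=> i phi phi0 mphi; exact: (integral_joint_law_kernel (nuE i)).
- by move=> y; rewrite lee_fin.
Qed.

End private_model.

(** * The two-point bound for private estimators *)

Lemma prode_EFin (R : realType) (I : Type) (r : seq I) (F : I -> R) :
  (\prod_(i <- r) (F i)%:E = (\prod_(i <- r) F i)%:E)%E.
Proof. by elim: r => [|i r IHr]; rewrite ?big_nil ?big_cons ?IHr. Qed.

Lemma lee_prode (R : realType) (I : Type) (r : seq I) (F G : I -> \bar R) :
  (forall i, 0 <= F i <= G i)%E ->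
  (\prod_(i <- r) F i <= \prod_(i <- r) G i)%E.
Proof.
move=> FG.
have /andP[//] : (0 <= \prod_(i <- r) F i <= \prod_(i <- r) G i)%E.
apply: (big_ind2 (fun x y : \bar R => 0 <= x <= y)%E) => [|x y x' y'|i _].
- by rewrite lexx lee_fin ler01.
- by move=> /andP[x0 xy] /andP[x'0 xy']; rewrite mule_ge0//= lee_pmul.
- exact: FG.
Qed.

Section two_point.
Context (R : realType) d (T : measurableType d).

(** The privacy inequality is averaged over [x] under [m2], then over [x'] under [m0]. The two data
    laws are arbitrary, so the bound does not deteriorate as the bell narrows. *)
Lemma private_marginal_le (alpha : R) (Q : R.-pker R ~> T) (m0 m2 : probability R R) B :
  measurable B -> (forall x x', Q x B <= (expR alpha)%:E * Q x' B)%E ->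
  (\int[m2]_x Q x B <= (expR alpha)%:E * \int[m0]_x Q x B)%E.
Proof.
move=> mB QB; have mQ := measurable_kernel Q B mB.
have e0 : (0 <= (expR alpha)%:E)%E by rewrite lee_fin expR_ge0.
have Q2 x' : (\int[m2]_x Q x B <= (expR alpha)%:E * Q x' B)%E.
  apply: (@le_trans _ _ (\int[m2]_x cst ((expR alpha)%:E * Q x' B) x)%E).
    by apply: ge0_le_integral => //= x _; rewrite mule_ge0.
  by rewrite integral_cst//= probability_setT mule1.
rewrite -ge0_integralZl//.
apply: (@le_trans _ _ (\int[m0]_x' cst (\int[m2]_x Q x B) x')%E).
  by rewrite integral_cst//= probability_setT mule1.
apply: ge0_le_integral => //=.
- by move=> x _; exact: integral_ge0.
- exact: measurable_funeM.
Qed.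

(** Both models occur in the supremum, so the worst-case risk bounds both errors. The error under
    [f1] is rewritten under the model of [f0] with the likelihood ratio of the views as weight, and
    this ratio has second moment at most [(1 + a^2 exp alpha)^n] by independence. *)
Lemma private_two_point_bound n (Q : 'I_n -> R.-pker R ~> T) (alpha s L t a : R)
    (f0 f2 : R -> R) (ell : n.-tuple T -> R) :
  let f1 := fun x => (1 - a) * f0 x + a * f2 x in
  locally_private alpha 0 Q -> measurable_fun [set: n.-tuple T] ell ->
  0 <= a <= 1 -> probability_density f2 ->
  sobolev_ellipsoid s L f0 -> sobolev_ellipsoid s L f1 ->
  (((continuous_version f1 t - continuous_version f0 t) ^+ 2 /
     (2 * ((1 + a ^+ 2 * expR alpha) ^+ n + 1)))%:E
   <= worst_case_risk s L t Q ell)%E.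
Proof.
move=> f1 Qpriv mell a01 f2_dens f0_sob f1_sob.
have [f0_dens _] := f0_sob; have [f1_dens _] := f1_sob.
have [m0 [m0E m0I]] := probability_density_law f0_dens.
have [m1 [m1E m1I]] := probability_density_law f1_dens.
have [m2 [m2E m2I]] := probability_density_law f2_dens.
have [nu0 nu0E] := choice (fun i => kernel_joint_law m0 (Q i)).
have [nu1 nu1E] := choice (fun i => kernel_joint_law m1 (Q i)).
have [nu2 nu2E] := choice (fun i => kernel_joint_law m2 (Q i)).
pose sndT : {mfun (R * T)%type >-> T} :=
  HB.pack (snd : (R * T)%type -> T) (isMeasurableFun.Build _ _ _ _ _ measurable_snd).
have distE (P : probability (R * T)%type R) B :
  (distribution P sndT : probability T R) B = P (snd @^-1` B) by [].
(* [rho] is a function of the view alone: it compares the marginal laws of the views, not the joint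
   laws with the data. *)
have lr i : exists rho : T -> R, [/\ forall z, 0 <= rho z,
    measurable_fun [set: T] rho,
    forall B, measurable B ->
      nu1 i (snd @^-1` B) = (\int[nu0 i]_(z in snd @^-1` B) (rho z.2)%:E)%E
  & (\int[nu0 i]_z (rho z.2 ^+ 2)%:E <= (1 + a ^+ 2 * expR alpha)%:E)%E].
  have [||rho [rho0 mrho rhoE rho2]] := @mixture_likelihood_ratio _ T R
    (distribution (nu0 i) sndT) (distribution (nu1 i) sndT)
    (distribution (nu2 i) sndT) a (expR alpha) a01 (expR_ge0 _).
  - move=> B mB; rewrite !distE (joint_law_snd (nu2E i))// (joint_law_snd (nu0E i))//.
    apply: private_marginal_le => // x x'.
    by rewrite (le_trans (Qpriv i x x' B mB))// adde0.
  - move=> B mB; rewrite !distE.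
    have mQ := measurable_kernel (Q i) B mB.
    rewrite (joint_law_snd (nu0E i))// (joint_law_snd (nu1E i))//.
    rewrite (joint_law_snd (nu2E i))//.
    rewrite m0I// m1I// m2I//.
    have mQf (f : R -> R) : probability_density f ->
        measurable_fun [set: measurableTypeR R] (fun x => Q i x B * (f x)%:E)%E.
      by move=> [mf _ _]; apply: emeasurable_funM => //; exact/measurable_EFinP.
    have Qf0 (f : R -> R) x : probability_density f -> (0 <= Q i x B * (f x)%:E)%E.
      by move=> [_ f_ge0 _]; rewrite mule_ge0// lee_fin.
    have a0 : (0 <= a%:E)%E by rewrite lee_fin; case/andP: a01.
    have a1 : (0 <= (1 - a)%:E)%E by rewrite lee_fin subr_ge0; case/andP: a01.
    rewrite -!ge0_integralZl//; try (by move=> x _; exact: Qf0); try exact: mQf.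
    rewrite -ge0_integralD//; try (by move=> x _; rewrite mule_ge0// Qf0);
      try (by apply: measurable_funeM; exact: mQf).
    apply: eq_integral => x _; rewrite EFinD !EFinM.
    have [_ f00 _] := f0_dens; have [_ f20 _] := f2_dens.
    by rewrite ge0_muleDr ?mule_ge0 ?lee_fin// !(muleCA (Q i x B)).
  exists rho; split => //.
  - move=> B mB; have := rhoE B mB.
    rewrite distE ge0_integral_pushforward//.
      exact/measurable_EFinP/measurable_funTS.
    by move=> z _; rewrite lee_fin.
  - move: rho2; rewrite ge0_integral_distribution//.
      by apply/measurable_EFinP; exact: measurable_funX.
    by move=> z; rewrite lee_fin sqr_ge0.
have [rho rhoP] := choice lr.
have rho0 i z : 0 <= rho i z by have [] := rhoP i.
have mrho i : measurable_fun [set: T] (rho i) by have [] := rhoP i.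
pose ell' (w : n.-tuple (R * T)) := ell [tuple model_view i w | i < n].
pose rhoW (w : n.-tuple (R * T)) := \prod_(i < n) rho i (tnth w i).2.
have mapE (w : n.-tuple (R * T)) : [tuple model_view i w | i < n] = map_tuple snd w.
  by apply/eq_from_tnth => i; rewrite tnth_mktuple tnth_map.
have mrho2 i : measurable_fun [set: R * T] (fun z : R * T => (rho i z.2)%:E).
  by apply/measurable_EFinP; apply: measurableT_comp.
have Irho i : (\int[nu0 i]_z (rho i z.2)%:E = 1)%E.
  have [_ _ /(_ setT measurableT) + _] := rhoP i.
  by rewrite preimage_setT probability_setT.
apply: (@two_point_bound R _ _ (tuple_law nu0) ell' rhoW).
- rewrite -[leLHS](expr1n _ n) lerXn2r ?nnegrE//; last first.
    by rewrite lerDl mulr_ge0 ?sqr_ge0// expR_ge0.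
  by rewrite addr_ge0// mulr_ge0 ?sqr_ge0// expR_ge0.
- rewrite /ell'; under eq_fun do rewrite mapE.
  by apply: measurableT_comp mell _; exact: measurable_map_tuple.
- apply: measurable_prod => i _; apply: measurableT_comp => //.
  exact: measurable_model_view.
- by move=> w; apply: prodr_ge0.
- under eq_integral do rewrite /rhoW -prode_EFin.
  rewrite (@integral_tuple_law_prod _ _ R n nu0 (fun i z => (rho i z.2)%:E))//.
  + by rewrite big1.
  + by move=> i z; rewrite lee_fin.
- under eq_integral do rewrite /rhoW -prodrXl -prode_EFin.
  rewrite (@integral_tuple_law_prod _ _ R n nu0 (fun i z => (rho i z.2 ^+ 2)%:E))//.
  + have -> : (1 + a ^+ 2 * expR alpha) ^+ n =
        \prod_(i < n) (1 + a ^+ 2 * expR alpha) by rewrite prodr_const card_ord.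
    rewrite -prode_EFin; apply: lee_prode => i.
    have [_ _ _ ->] := rhoP i; rewrite andbT.
    by apply: integral_ge0 => z _; rewrite lee_fin sqr_ge0.
  + by move=> i z; rewrite lee_fin sqr_ge0.
  + move=> i; apply/measurable_EFinP; apply: measurable_funX.
    exact: measurableT_comp.
- apply: ereal_sup_ubound; exists f0; split=> //.
  exists _, _, (tuple_law nu0), (fun i => model_data i), (fun i => model_view i); split.
  + exact: model_iid m0E nu0E.
  + exact: model_noninteractive nu0E.
  + by rewrite unlock.
- apply: ereal_sup_ubound; exists f1; split=> //.
  exists _, _, (tuple_law nu1), (fun i => model_data i), (fun i => model_view i); split.
  + exact: model_iid m1E nu1E.
  + exact: model_noninteractive nu1E.
  + rewrite unlock; pose G y := ((ell y - continuous_version f1 t) ^+ 2)%:E.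
    (* The estimator sees only the views, so the joint law under [f1] can be replaced along [snd] by
       the one under [f0] weighted by [rho]. *)
    have := @integral_tuple_law_tensor _ (R * T)%type _ T R n nu1 nu0 snd
      (fun _ => cst 1%E) (fun i z => (rho i z.2)%:E) G.
    move=> tensor.
    transitivity (\int[tuple_law nu1]_w
        (G (map_tuple snd w) * \prod_(i < n) cst 1 (tnth w i)))%E; last first.
      by apply: eq_integral => w _; rewrite big1// mule1 /G -mapE.
    rewrite tensor//.
    * apply: eq_integral => w _.
      by rewrite prode_EFin -EFinM /G -mapE.
    * by move=> i z; rewrite lee_fin.
    * move=> i phi phi0 mphi.
      apply: (@eq_integral_preimage _ _ _ _ _ _ _ (nu1 i) (nu0 i) snd snd
        (cst 1%E) (fun z => (rho i z.2)%:E)) => //.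
      + by move=> z; rewrite lee_fin.
      + have -> : (\int[nu1 i]_x cst 1 x = 1)%E.
          by rewrite integral_cst//= probability_setT mule1.
        by rewrite ltry.
      + move=> B mB; rewrite integral_cst ?mul1e.
          by have [_ _ /(_ B mB)] := rhoP i.
        by rewrite -setTX; exact: measurableX.
    * by move=> y; rewrite lee_fin sqr_ge0.
    * apply/measurable_EFinP; apply: measurable_funX.
      exact: measurable_funB.
Qed.

End two_point.

(** * Continuous versions and Fourier decay *)

Section continuous_version.
Context {R : realType}.
Local Notation mu := (@lebesgue_measure R).

(** Continuous functions that differ at a point differ on a ball around it, which has positive
    measure. *)
Lemma ae_eq_continuous (f g : R -> R) : continuous f -> continuous g ->
  {ae mu, forall x, g x = f x} -> g = f.
Proof.
move=> cf cg [N [mN N0 fgN]]; apply/funext => t; apply/eqP/negPn/negP => gft.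
have : \forall x \near t, g x - f x != 0.
  have cgf : (g \- f) x @[x --> t] --> (g \- f) t by apply: cvgB; [exact: cg|exact: cf].
  have gft0 : (g \- f) t != 0 by rewrite subr_eq0.
  exact: (cvgr_neq0 _ cgf gft0).
move=> /nbhs_ballP[e /= e0 eN].
have : (mu (ball t e) <= mu N)%E.
  apply: le_measure; rewrite ?inE//; first exact: measurable_ball.
  move=> x /eN gfx; apply: fgN => /= gx; move: gfx.
  by rewrite gx subrr eqxx.
by rewrite N0 lebesgue_measure_ball ?(ltW e0)// leNgt lte_fin pmulrn_lgt0 ?e0.
Qed.

(** Removes the choice made by [xget]: [f] itself qualifies, and there is only one candidate. *)
Lemma continuous_version_id (f : R -> R) : continuous f -> continuous_version f = f.
Proof.
move=> cf; rewrite /continuous_version.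
set A := [set _ | _].
have Af : A f by split => //; exact: aeW.
have [cg gf] : A (xget f A) by exact: (xgetPex f (ex_intro _ f Af)).
exact: ae_eq_continuous.
Qed.

(* Unlike [ge0_le_integral] this asks for no measurability, which spares us that
   of the Fourier transform. *)
Lemma le_nnintegral d (T : measurableType d) (m : {measure set T -> \bar R})
    (f g : T -> \bar R) : (forall x, 0 <= f x)%E -> (forall x, f x <= g x)%E ->
  (\int[m]_x f x <= \int[m]_x g x)%E.
Proof.
move=> f0 fg.
rewrite !ge0_integralTE//; last by move=> x; exact: le_trans (fg x).
apply: le_ereal_sup => _ [h hf <-]; exists h => // x.
exact: le_trans (hf x) (fg x).
Qed.

End continuous_version.

Section trigonometric_decay.
Context {R : realType}.
Local Notation mu := (@lebesgue_measure R).
Implicit Types (p q : {poly R}).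

Lemma integrable_segment_continuous (a b : R) (g : R -> R) : continuous g ->
  mu.-integrable `[a, b] (EFin \o g).
Proof.
move=> cg; apply: continuous_compact_integrable; first exact: segment_compact.
exact: continuous_subspaceT.
Qed.

(** [G / w] is a primitive of [g]. The pair is abstract so as to cover both ([sin], [cos]) and
    ([cos], [- sin]). *)
Lemma poly_by_parts p (a b w : R) (G g : R -> R) : a < b -> w != 0 ->
  p.[a] = 0 -> p.[b] = 0 ->
  continuous g -> (forall x : R, is_derive x 1 G (w * g x)) ->
  \int[mu]_(x in `[a, b]) (p.[x] * g x) =
  - w^-1 * \int[mu]_(x in `[a, b]) (p^`().[x] * G x).
Proof.
move=> ab w0 pa pb cg dG.
have cG : continuous G.
  move=> x; apply: differentiable_continuous; apply/derivable1_diffP.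
  exact: ex_derive.
have LR (F : R -> R) : (forall x, derivable F x 1) -> continuous F ->
    derivable_oo_LRcontinuous F a b.
  move=> dF cF; split; first by move=> x _; exact: dF.
    by apply: cvg_at_right_filter; exact: cF.
  by apply: cvg_at_left_filter; exact: cF.
have dwG (x : R) : is_derive x (1 : R) (w^-1 \*: G) (g x).
  by have := is_deriveZ w^-1 (dG x); rewrite /GRing.scale/= mulrA mulVf// mul1r.
rewrite (@Rintegration_by_parts _ (horner p) (w^-1 \*: G) (horner p^`()) g)//.
- rewrite pa pb !mul0r subrr sub0r mulNr -RintegralZl//; last first.
    apply: integrable_segment_continuous => x.
    by apply: cvgM; [exact: continuous_horner|exact: cG].
  by congr (- _); apply: eq_Rintegral => x _ /=; rewrite mulrCA.
- by apply: continuous_subspaceT => x; exact: continuous_horner.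
- by apply: LR => x; [exact: derivable_horner|exact: continuous_horner].
- by move=> x _; rewrite derivE.
- exact: continuous_subspaceT.
- apply: LR => x; first exact: ex_derive.
  by apply: cvgZr; exact: cG.
- by move=> x _; rewrite derive1E derive_val.
Qed.

(* By [k] integrations by parts, whose boundary terms all vanish. *)
Lemma trig_integral_decay p (a b w : R) k : a < b -> w != 0 ->
  (forall j, (j < k)%N -> p^`(j).[a] = 0 /\ p^`(j).[b] = 0) ->
  `|\int[mu]_(x in `[a, b]) (p.[x] * cos (w * x))| <=
    (`|w| ^+ k)^-1 * \int[mu]_(x in `[a, b]) `|p^`(k).[x]| /\
  `|\int[mu]_(x in `[a, b]) (p.[x] * sin (w * x))| <=
    (`|w| ^+ k)^-1 * \int[mu]_(x in `[a, b]) `|p^`(k).[x]|.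
Proof.
move=> ab w0.
have dw (x : R) : is_derive x (1 : R) ( *%R w) w.
  by have := is_deriveZ w (@is_derive_id _ _ x 1); rewrite /GRing.scale/= mulr1.
have dsin (x : R) : is_derive x (1 : R) (fun x => sin (w * x)) (w * cos (w * x)).
  by rewrite mulrC; exact: (@is_derive1_comp _ sin ( *%R w)).
have dcos (x : R) : is_derive x (1 : R) (fun x => cos (w * x)) (w * - sin (w * x)).
  by rewrite mulrC; exact: (@is_derive1_comp _ cos ( *%R w)).
have is_derive_continuous (g g' : R -> R) :
    (forall x : R, is_derive x 1 g (g' x)) -> continuous g.
  move=> dg x; apply: differentiable_continuous; apply/derivable1_diffP.
  exact: ex_derive.
have csin := is_derive_continuous _ _ dsin.
have ccos := is_derive_continuous _ _ dcos.
(* Integration by parts exchanges cosine and sine, so the two bounds go through the induction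
   together, for all polynomials. *)
elim: k p => [|k IHk] p p0.
  have base (g : R -> R) : continuous g -> (forall x, `|g x| <= 1) ->
      `|\int[mu]_(x in `[a, b]) (p.[x] * g x)| <= \int[mu]_(x in `[a, b]) `|p.[x]|.
    move=> cg g1.
    have cpg : continuous (fun x => p.[x] * g x).
      by move=> x; apply: cvgM; [exact: continuous_horner|exact: cg].
    have cnorm (f : R -> R) : continuous f -> continuous (fun x => `|f x|).
      by move=> cf x; apply: cvg_norm; exact: cf.
    apply: le_trans (le_normr_Rintegral _ _) _ => //.
      exact: integrable_segment_continuous.
    apply: le_Rintegral => //.
    - exact/integrable_segment_continuous/cnorm.
    - exact/integrable_segment_continuous/cnorm/continuous_horner.
    - by move=> x _; rewrite normrM ler_piMr.
  rewrite expr0 invr1 !mul1r; split; apply: base => // x.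
    by rewrite ler_norml cos_geN1 cos_le1.
  by rewrite ler_norml sin_geN1 sin_le1.
have [pa pb] := p0 0%N isT.
have p'0 j : (j < k)%N -> p^`()^`(j).[a] = 0 /\ p^`()^`(j).[b] = 0.
  by move=> jk; rewrite -derivSn; exact: (p0 j.+1).
have [IHc IHs] := IHk _ p'0.
have wV0 : 0 <= `|w|^-1 by rewrite invr_ge0.
rewrite derivSn exprS invfM -mulrA; split.
- rewrite (@poly_by_parts p a b w (fun x => sin (w * x)) (fun x => cos (w * x)))//.
  by rewrite normrM normrN normfV ler_wpM2l.
- have -> : \int[mu]_(x in `[a, b]) (p.[x] * sin (w * x)) =
      - \int[mu]_(x in `[a, b]) (p.[x] * - sin (w * x)).
    rewrite -mulN1r -RintegralZl//; last first.
      apply: integrable_segment_continuous => x; apply: cvgM.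
        exact: continuous_horner.
      by apply: cvgN; exact: csin.
    by apply: eq_Rintegral => x _; rewrite mulrN mulrNN mul1r.
  rewrite (@poly_by_parts p a b w (fun x => cos (w * x)) (fun x => - sin (w * x)))//.
    by rewrite normrN normrM normrN normfV ler_wpM2l.
  by move=> x; apply: cvgN; exact: csin.
Qed.

End trigonometric_decay.

(** * Bell profiles and their Fourier transforms *)

Section bell.
Context {R : realType}.
Local Notation mu := (@lebesgue_measure R).
Implicit Types (p q : {poly R}) (m : nat) (t h x : R).

Lemma horner_bounded p : exists2 M : R, 0 <= M & forall u, `|u| <= 1 -> `|p.[u]| <= M.
Proof.
elim/poly_ind: p => [|p c [M M0 pM]].
  by exists 0 => // u _; rewrite horner0 normr0.
exists (M + `|c|) => [|u u1]; first by rewrite addr_ge0.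
rewrite !hornerE (le_trans (ler_normD _ _))// lerD2r normrM.
by rewrite -[leRHS]mulr1 ler_pM// pM.
Qed.

(** Each derivative lowers the multiplicity of the factor [p] by at most one. *)
Lemma derivn_exp_multiple p m j : (j <= m)%N ->
  exists q, (p ^+ m)^`(j) = p ^+ (m - j) * q.
Proof.
elim: j => [|j IHj] jm; first by exists 1; rewrite derivn0 subn0 mulr1.
have [q qE] := IHj (ltnW jm).
rewrite derivnS qE derivM deriv_exp -(subnSK jm) /=.
exists (p^`() *+ (m - j.+1).+1 * q + p * q^`()).
by rewrite exprS; ring.
Qed.

Lemma derivn_comp_affine p (a b : R) k :
  (p \Po (a *: 'X + b%:P))^`(k) = a ^+ k *: (p^`(k) \Po (a *: 'X + b%:P)).
Proof.
elim: k => [|k IHk]; first by rewrite !derivn0 expr0 scale1r.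
rewrite !derivnS IHk derivZ deriv_comp derivD derivZ derivX derivC addr0.
by rewrite -scalerAr mulr1 scalerA exprSr.
Qed.

(** The profile [(1 - u^2)_+^m] in the variable [u = (x - t) / h]. Being a polynomial on its
    support, it has algebraic derivatives, and those of order below [m] vanish at the edges, which
    is enough for [m] integrations by parts. *)
Definition bell m t h x : R := Num.max 0 (1 - ((x - t) / h) ^+ 2) ^+ m.

Lemma bell_ge0 m t h x : 0 <= bell m t h x.
Proof. by rewrite exprn_ge0// le_max lexx. Qed.

Lemma bell_le1 m t h x : bell m t h x <= 1.
Proof.
rewrite exprn_ile1 ?le_max ?lexx// ge_max ler01 gerBl.
exact: sqr_ge0.
Qed.

Lemma bell_center m t h : bell m t h t = 1.
Proof. by rewrite /bell subrr mul0r expr0n subr0 max_r// expr1n. Qed.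

Lemma continuous_bell m t h : continuous (bell m t h).
Proof.
move=> x; apply: (@continuous_comp _ _ _ (fun x => Num.max 0 (1 - ((x - t) / h) ^+ 2))
  (fun y => y ^+ m)); last exact: exprn_continuous.
apply: (@continuous_max _ _ (cst 0) (fun x => 1 - ((x - t) / h) ^+ 2)).
  exact: cvg_cst.
have -> : (fun x : R => 1 - ((x - t) / h) ^+ 2) =
    horner ((1 - 'X ^+ 2) \Po (h^-1 *: 'X + (- t / h)%:P)).
  by apply/funext => y; rewrite horner_comp !hornerE; ring.
exact: continuous_horner.
Qed.

Let bell_supportE t h : 0 < h -> forall x,
  (`|(x - t) / h| <= 1) = (x \in `[t - h, t + h]).
Proof.
move=> h0 x; rewrite in_itv/= normrM normfV (gtr0_norm h0) ler_pdivrMr// mul1r.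
by rewrite ler_distl.
Qed.

Definition bell_poly m t h : {poly R} :=
  ((1 - 'X ^+ 2) ^+ m) \Po (h^-1 *: 'X + (- t / h)%:P).

Lemma bell_polyE m t h x : 0 < h -> x \in `[t - h, t + h] ->
  bell m t h x = (bell_poly m t h).[x].
Proof.
move=> h0; rewrite -bell_supportE// => xth.
rewrite /bell max_r; last by rewrite subr_ge0 -real_normK ?num_real// expr_le1.
by rewrite /bell_poly horner_comp !hornerE; congr (_ ^+ _); ring.
Qed.

Lemma bell_out m t h x : (0 < m)%N -> 0 < h -> x \notin `[t - h, t + h] ->
  bell m t h x = 0.
Proof.
move=> m0 h0; rewrite -bell_supportE// -ltNge => xth.
rewrite /bell max_l ?expr0n ?gtn_eqF// subr_le0 -real_normK ?num_real//.
by rewrite expr_ge1// ltW.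
Qed.

Lemma Rintegral_bell m t h (g : R -> R) : (0 < m)%N -> 0 < h ->
  \int[mu]_x (g x * bell m t h x) =
  \int[mu]_(x in `[t - h, t + h]) ((bell_poly m t h).[x] * g x).
Proof.
move=> m0 h0; rewrite [RHS]Rintegral_mkcond; apply: eq_Rintegral => x _.
rewrite patchE; case: ifPn => xth.
  by rewrite (@bell_polyE m t h x)// 1?mulrC//; rewrite inE in xth.
by rewrite bell_out ?mulr0//; apply: contra xth => xth; rewrite inE.
Qed.

(** In the variable [u] the edges are -1 and 1, roots of [1 - u^2] and hence of multiplicity at
    least [m] in its [m]-th power. *)
Lemma bell_poly_deriv_edge m t h j : 0 < h -> (j < m)%N ->
  (bell_poly m t h)^`(j).[t - h] = 0 /\ (bell_poly m t h)^`(j).[t + h] = 0.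
Proof.
move=> h0 jm; rewrite derivn_comp_affine.
have [q ->] := @derivn_exp_multiple (1 - 'X ^+ 2) m j (ltnW jm).
have mj : ((m - j)%N == 0%N) = false by rewrite subn_eq0 leqNgt jm.
have h1 : h != 0 by rewrite gt_eqF.
rewrite !hornerE !horner_comp !hornerE.
have -> : h^-1 * (t - h) + - t / h = -1 by field.
have -> : h^-1 * (t + h) + - t / h = 1 by field.
by rewrite sqrrN expr1n subrr expr0n mj /= mulr0 !mul0r.
Qed.

(** The [m]-th derivative of the bell is at most [h^(-m)] times a bound for that of [(1 - u^2)^m] on
    [-1, 1], over an interval of length [2 h]; hence a constant uniform in [t] and [h]. *)
Lemma bell_fourier_decay m : (0 < m)%N -> exists2 M : R, 0 <= M &
  forall t h w, 0 < h -> w != 0 ->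
    `|\int[mu]_x (cos (w * x) * bell m t h x)| <= M * h / (`|w| * h) ^+ m /\
    `|\int[mu]_x (sin (w * x) * bell m t h x)| <= M * h / (`|w| * h) ^+ m.
Proof.
move=> m0; have [M M0 pM] := horner_bounded ((1 - 'X ^+ 2) ^+ m)^`(m).
exists (2 * M) => [|t h w h0 w0]; first by rewrite mulr_ge0.
rewrite (Rintegral_bell _ (fun x => cos (w * x)))//.
rewrite (Rintegral_bell _ (fun x => sin (w * x)))//.
have ab : t - h < t + h by rewrite ltrD2l gtrN.
have [IC IS] := trig_integral_decay ab w0 (fun j => @bell_poly_deriv_edge m t h j h0).
have IM : \int[mu]_(x in `[t - h, t + h]) `|(bell_poly m t h)^`(m).[x]| <=
    2 * h * (h^-1 ^+ m * M).
  apply: (@le_trans _ _ (\int[mu]_(x in `[t - h, t + h]) (h^-1 ^+ m * M))).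
    apply: le_Rintegral => //.
    - apply: integrable_segment_continuous => x; apply: cvg_norm.
      exact: continuous_horner.
    - by apply: integrable_segment_continuous => x; exact: cvg_cst.
    move=> x /= xth; rewrite derivn_comp_affine hornerE normrM normrX normfV.
    rewrite (gtr0_norm h0) ler_wpM2l ?exprn_ge0 ?invr_ge0 ?(ltW h0)//.
    rewrite horner_comp pM// !hornerE.
    by have := bell_supportE t h0 x; rewrite xth mulrBl (mulrC x) mulNr => ->.
  rewrite Rintegral_cst//= lebesgue_measure_itv/= lte_fin ab -EFinB/= opprB addrA.
  by rewrite le_eqVlt; apply/orP; left; apply/eqP; ring.
have E : (`|w| ^+ m)^-1 * (2 * h * (h^-1 ^+ m * M)) = 2 * M * h / (`|w| * h) ^+ m.
  by rewrite exprMn invfM exprVn; ring.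
by split; [apply: le_trans IC _|apply: le_trans IS _];
  rewrite -E ler_wpM2l// invr_ge0 exprn_ge0.
Qed.

Lemma integrable_bell m t h (g : R -> R) : (0 < m)%N -> 0 < h -> continuous g ->
  mu.-integrable setT (EFin \o (fun x => g x * bell m t h x)).
Proof.
move=> m0 h0 cg.
have cgb : continuous (fun x => g x * bell m t h x).
  by move=> x; apply: cvgM; [exact: cg|exact: continuous_bell].
have -> : (fun x => g x * bell m t h x) =
    (fun x => g x * bell m t h x) \_ `[t - h, t + h].
  apply/funext => x; rewrite patchE; case: ifPn => // xth.
  by rewrite bell_out ?mulr0//; apply: contra xth => xth; rewrite inE.
rewrite -restrict_EFin; apply/integrable_restrict => //; rewrite setTI.
exact: integrable_segment_continuous.
Qed.

Definition bell_mass m t h : R := \int[mu]_x bell m t h x.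

Let bell_massE m t h : (0 < m)%N -> 0 < h ->
  bell_mass m t h = \int[mu]_(x in `[t - h, t + h]) bell m t h x.
Proof.
move=> m0 h0; rewrite [RHS]Rintegral_mkcond; apply: eq_Rintegral => x _.
rewrite patchE; case: ifPn => // xth.
by rewrite bell_out//; apply: contra xth => xth; rewrite inE.
Qed.

Lemma bell_mass_le m t h : (0 < m)%N -> 0 < h -> bell_mass m t h <= 2 * h.
Proof.
move=> m0 h0; rewrite bell_massE//.
apply: (@le_trans _ _ (\int[mu]_(x in `[t - h, t + h]) 1)).
  apply: le_Rintegral => //.
  - exact/integrable_segment_continuous/continuous_bell.
  - by apply: integrable_segment_continuous => x; exact: cvg_cst.
  - by move=> x _; exact: bell_le1.
have ab : t - h < t + h by rewrite ltrD2l gtrN.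
rewrite Rintegral_cst//= lebesgue_measure_itv/= lte_fin ab -EFinB/=.
by lra.
Qed.

(** On the middle half of the support [|u| <= 1/2], so [1 - u^2 >= 3/4]. *)
Lemma bell_mass_ge m t h : (0 < m)%N -> 0 < h -> (3 / 4) ^+ m * h <= bell_mass m t h.
Proof.
move=> m0 h0.
have ab : t - h / 2 < t + h / 2 by lra.
apply: (@le_trans _ _ (\int[mu]_(x in `[t - h / 2, t + h / 2]) bell m t h x)).
  apply: (@le_trans _ _ (\int[mu]_(x in `[t - h / 2, t + h / 2]) (3 / 4) ^+ m)).
    rewrite Rintegral_cst//= lebesgue_measure_itv/= lte_fin ab -EFinB/=.
    by rewrite ler_wpM2l ?exprn_ge0//; lra.
  apply: le_Rintegral => //.
  - by apply: integrable_segment_continuous => x; exact: cvg_cst.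
  - exact/integrable_segment_continuous/continuous_bell.
  - move=> x /=; rewrite in_itv/= => /andP[x1 x2].
    have : `|(x - t) / h| <= 1 / 2.
      rewrite normrM normfV (gtr0_norm h0) ler_pdivrMr// ler_norml.
      by apply/andP; split; lra.
    set u := (x - t) / h => u1.
    rewrite /bell -/u max_r; last first.
      by rewrite subr_ge0 -real_normK ?num_real// expr_le1//; lra.
    rewrite lerXn2r ?nnegrE ?divr_ge0// -real_normK ?num_real//.
      have := normr_ge0 u; nra.
    have := normr_ge0 u; nra.
rewrite Rintegral_mkcond; apply: le_Rintegral => //.
- rewrite -restrict_EFin; apply/integrable_restrict => //; rewrite setTI.
  exact/integrable_segment_continuous/continuous_bell.
- have -> : (bell m t h) = (fun x => cst 1 x * bell m t h x).
    by apply/funext => x; rewrite mul1r.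
  by apply: integrable_bell => // x; exact: cvg_cst.
- by move=> x _; rewrite patchE; case: ifP => // _; exact: bell_ge0.
Qed.

End bell.

Section bell_density.
Context {R : realType}.
Local Notation mu := (@lebesgue_measure R).
Implicit Types (m : nat) (t h x : R).

Definition bell_density m t h x : R := (bell_mass m t h)^-1 * bell m t h x.

Let kappa m : R := (3 / 4) ^+ m.
Let kappa_gt0 m : 0 < kappa m. Proof. by rewrite exprn_gt0// divr_gt0. Qed.

Lemma bell_mass_gt0 m t h : (0 < m)%N -> 0 < h -> 0 < bell_mass m t h.
Proof.
move=> m0 h0; apply: lt_le_trans (bell_mass_ge t m0 h0).
by rewrite mulr_gt0.
Qed.

Lemma continuous_bell_density m t h : continuous (bell_density m t h).
Proof. by move=> x; apply: cvgM; [exact: cvg_cst|exact: continuous_bell]. Qed.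

Let integrable_bell1 m t h : (0 < m)%N -> 0 < h ->
  mu.-integrable setT (EFin \o bell m t h).
Proof.
move=> m0 h0; have -> : bell m t h = (fun x => cst 1 x * bell m t h x).
  by apply/funext => x; rewrite mul1r.
by apply: integrable_bell => // x; exact: cvg_cst.
Qed.

Lemma probability_bell_density m t h : (0 < m)%N -> 0 < h ->
  probability_density (bell_density m t h).
Proof.
move=> m0 h0; have N0 := bell_mass_gt0 t m0 h0.
split.
- by apply: continuous_measurable_fun; exact: continuous_bell_density.
- by move=> x; rewrite mulr_ge0 ?bell_ge0// invr_ge0 ltW.
have ib := integrable_bell1 t m0 h0.
under eq_integral do rewrite EFinM.
rewrite integralZl//= -[X in (_ * X)%E](@fineK R) ?integrable_fin_num//.
by rewrite -EFinM -/(Rintegral _ _ _) mulVf// gt_eqF.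
Qed.

Lemma bell_density_center m t h : (0 < m)%N -> 0 < h ->
  (2 * h)^-1 <= bell_density m t h t <= ((3 / 4) ^+ m * h)^-1.
Proof.
move=> m0 h0; rewrite /bell_density bell_center mulr1.
have N0 := bell_mass_gt0 t m0 h0.
have h20 : 0 < 2 * h by rewrite mulr_gt0.
have kh0 : 0 < (3 / 4) ^+ m * h by rewrite mulr_gt0// kappa_gt0.
rewrite !lef_pV2 ?posrE//.
by rewrite bell_mass_le// bell_mass_ge.
Qed.

Lemma integrable_bell_density m t h (g : R -> R) : (0 < m)%N -> 0 < h ->
  continuous g -> mu.-integrable setT (EFin \o (fun x => g x * bell_density m t h x)).
Proof.
move=> m0 h0 cg.
have -> : (EFin \o (fun x => g x * bell_density m t h x)) =
    (fun x => (bell_mass m t h)^-1%:E * (EFin \o (fun x => g x * bell m t h x)%R) x)%E.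
  by apply/funext => x /=; rewrite -EFinM /bell_density mulrCA.
by apply: integrableZl => //; exact: integrable_bell.
Qed.

(** Treats cosine and sine at once. The first bound is total mass 1; in the second, dividing by a
    mass of order [h] cancels the factor [h] of the decay. *)
Lemma bell_density_trig m (g : R -> R -> R) M : (0 < m)%N -> 0 <= M ->
  (forall w, continuous (g w)) -> (forall w x, `|g w x| <= 1) ->
  (forall t h w, 0 < h -> w != 0 ->
    `|\int[mu]_x (g w x * bell m t h x)| <= M * h / (`|w| * h) ^+ m) ->
  forall t h w, 0 < h ->
    `|\int[mu]_x (g w x * bell_density m t h x)| <= 1 /\
    (w != 0 -> `|\int[mu]_x (g w x * bell_density m t h x)| <=
      (M / (3 / 4) ^+ m) / (`|w| * h) ^+ m).
Proof.
move=> m0 M0 cg g1 gM t h w h0; have N0 := bell_mass_gt0 t m0 h0.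
have IE : \int[mu]_x (g w x * bell_density m t h x) =
    (bell_mass m t h)^-1 * \int[mu]_x (g w x * bell m t h x).
  rewrite -RintegralZl//; last exact: integrable_bell.
  by apply: eq_Rintegral => x _; rewrite /bell_density mulrCA.
rewrite IE normrM normfV (gtr0_norm N0); split => [|w0].
  rewrite mulrC ler_pdivrMr// mul1r.
  apply: le_trans (le_normr_Rintegral _ _) _ => //; first exact: integrable_bell.
  apply: le_Rintegral => //; last 2 first.
  - exact: integrable_bell1.
  - by move=> x _; rewrite normrM (ger0_norm (bell_ge0 _ _ _ _)) ler_piMl ?bell_ge0.
  - have := integrable_bell (m := m) t m0 h0 (cg w).
    by move=> /integrable_norm.
apply: (@le_trans _ _ ((kappa m * h)^-1 * (M * h / (`|w| * h) ^+ m))).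
  apply: ler_pM; rewrite ?invr_ge0 ?(ltW N0)//; last exact: gM.
  by rewrite lef_pV2 ?posrE ?mulr_gt0// bell_mass_ge.
rewrite le_eqVlt; apply/orP; left; apply/eqP; rewrite -/(kappa m).
set y := (_ ^+ m)^-1; field.
by rewrite !gt_eqF.
Qed.

(** Squares of the cosine and sine bounds are added, and one [D] serves both regimes. The case
    [w = 0] must be excluded from the second: there the quotient is 0 by convention, while the
    transform is 1. *)
Lemma bell_density_fourier m : (0 < m)%N -> exists2 D : R, 0 <= D &
  forall t h w, 0 < h ->
    let A := complex.ComplexField.Normc.normc (fourier (bell_density m t h) w) ^+ 2 in
    A <= D /\ (w != 0 -> A <= D / (`|w| * h) ^+ (2 * m)).
Proof.
move=> m0; have [M M0 decay] := bell_fourier_decay (R := R) m0.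
have cw (w : R) : continuous ( *%R w).
  by move=> x; apply: cvgM; [exact: cvg_cst|exact: cvg_id].
have C := @bell_density_trig m (fun w x => cos (w * x)) M m0 M0.
have S := @bell_density_trig m (fun w x => sin (w * x)) M m0 M0.
have {}C := C (fun w x => continuous_comp (cw w x) (@continuous_cos R _)).
have {}S := S (fun w x => continuous_comp (cw w x) (@continuous_sin R _)).
have cos1 (w x : R) : `|cos (w * x)| <= 1 by rewrite ler_norml cos_geN1 cos_le1.
have sin1 (w x : R) : `|sin (w * x)| <= 1 by rewrite ler_norml sin_geN1 sin_le1.
have {}C := C cos1 (fun t h w hp wp => (decay t h w hp wp).1).
have {}S := S sin1 (fun t h w hp wp => (decay t h w hp wp).2).
set K := M / (3 / 4) ^+ m in C S.
have K0 : 0 <= K by rewrite divr_ge0// ltW.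
exists (2 * (1 + K ^+ 2)) => [|t h w h0 A].
  by rewrite mulr_ge0 ?addr_ge0 ?sqr_ge0.
have AE : A = (\int[mu]_x (cos (w * x) * bell_density m t h x)) ^+ 2 +
    (\int[mu]_x (sin (w * x) * bell_density m t h x)) ^+ 2.
  by rewrite /A /fourier/= sqr_sqrtr// addr_ge0 ?sqr_ge0.
have sqle (x y : R) : `|x| <= y -> x ^+ 2 <= y ^+ 2.
  by move=> xy; rewrite -real_normK ?num_real// lerXn2r ?nnegrE ?(le_trans _ xy).
have [C1 C2] := C t h w h0; have [S1 S2] := S t h w h0.
rewrite AE; split => [|w0].
  have := sqle _ _ C1; have := sqle _ _ S1; rewrite expr1n.
  have := sqr_ge0 K; lra.
have := sqle _ _ (C2 w0); have := sqle _ _ (S2 w0).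
rewrite exprMn exprVn -exprM mulnC.
have : 0 <= ((`|w| * h) ^+ (2 * m))^-1 by rewrite invr_ge0 exprn_ge0// mulr_ge0// ltW.
set y := (_ ^+ (2 * m))^-1 => y0 c1 c2.
by nra.
Qed.

End bell_density.

(** * Sobolev energy of bell mixtures *)

Section energy.
Context {R : realType}.
Local Notation mu := (@lebesgue_measure R).

Lemma integralT_oneDsqrV : (\int[mu]_x ((oneDsqr x)^-1)%:E = pi%:E)%E.
Proof.
rewrite ge0_symfun_integralT; last 3 first.
- by move=> x; rewrite invr_ge0 (le_trans ler01)// oneDsqr_ge1.
- exact: continuous_oneDsqrV.
- by move=> x /=; rewrite /oneDsqr sqrrN.
rewrite -set_itvcy integral0y_oneDsqr -EFinM; congr EFin.
by rewrite mulrC divfK.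
Qed.

Lemma integralT_scaled_oneDsqrV (h : R) : 0 < h ->
  (\int[mu]_x ((1 + (h * x) ^+ 2)^-1)%:E = (pi / h)%:E)%E.
Proof.
move=> h0.
pose F : R -> R := *%R h.
have F'E : F^`()%classic = cst h.
  by apply/funext => x; rewrite /F derive1E deriveMl// derive_id mulr1.
have cG : continuous (fun x : R => (1 + (h * x) ^+ 2)^-1).
  move=> x; apply: (@continuous_comp _ _ _ F (fun y => (oneDsqr y)^-1)).
    by apply: cvgM; [exact: cvg_cst|exact: cvg_id].
  exact: continuous_oneDsqrV.
have G0 (x : R) : 0 <= (1 + (h * x) ^+ 2)^-1.
  by rewrite invr_ge0 addr_ge0 ?sqr_ge0.
have : (\int[mu]_x (((fun y => (oneDsqr y)^-1) \o F) x * F^`()%classic x)%:E = pi%:E)%E.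
  rewrite -integralT_oneDsqrV.
  rewrite [RHS](increasing_ge0_integration_by_substitutionT (F := F))//.
  - by move=> x y; rewrite /F ltr_pM2l.
  - by rewrite F'E => ?; exact: cvg_cst.
  - by rewrite F'E; exact: is_cvg_cst.
  - by rewrite F'E; exact: is_cvg_cst.
  - by apply: gt0_cvgMrNy => //; exact: cvg_id.
  - by apply: gt0_cvgMry => //; exact: cvg_id.
  - exact: continuous_oneDsqrV.
rewrite F'E; under eq_integral do rewrite EFinM /=.
rewrite ge0_integralZr//; last 2 first.
- by apply/measurable_EFinP; apply: continuous_measurable_fun; exact: cG.
- by rewrite lee_fin ltW.
move=> H; set X := (\int[_]_x _)%E in H *.
have -> : X = (X * h%:E * (h^-1)%:E)%E by rewrite -muleA -EFinM divff ?mule1// gt_eqF.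
by rewrite H -EFinM.
Qed.

(** With [u = |w| h]: if [u <= 1], then [A <= D] and [u^(2s) <= 1] suffice; if [u > 1], then
    [u^(2s) (1 + u^2) <= 2 u^(2m)] because [s + 1 <= m], and the decay absorbs [u^(2m)]. The Cauchy
    profile is chosen because its integral is explicit. *)
Lemma bell_envelope (A D s h w : R) (m : nat) : 0 < s -> s + 1 <= m%:R -> 0 < h ->
  0 <= A -> A <= D -> (w != 0 -> A <= D / (`|w| * h) ^+ (2 * m)) ->
  A * `|w| `^ (2 * s) <= 2 * D * h `^ (- (2 * s)) * (1 + (h * w) ^+ 2)^-1.
Proof.
move=> s0 sm h0 A0 AD Aw.
have D0 : 0 <= D by exact: le_trans AD.
have [->|w0] := eqVneq w 0.
  rewrite normr0 powR0 ?mulr0; last by rewrite mulf_neq0// gt_eqF.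
  by rewrite !mulr_ge0 ?powR_ge0// invr_ge0 addr_ge0 ?sqr_ge0.
set u := `|w| * h; have u0 : 0 < u by rewrite mulr_gt0 ?normr_gt0.
have -> : (h * w) ^+ 2 = u ^+ 2 by rewrite /u !exprMn real_normK ?num_real// mulrC.
have -> : `|w| `^ (2 * s) = u `^ (2 * s) * h `^ (- (2 * s)).
  rewrite /u powRM ?(ltW h0)// -mulrA powRN divff ?mulr1// gt_eqF//.
  exact: powR_gt0.
have hp : 0 < h `^ (- (2 * s)) by exact: powR_gt0.
have u21 : 0 < 1 + u ^+ 2 by rewrite ltr_pwDl ?sqr_ge0.
suff : A * u `^ (2 * s) * (1 + u ^+ 2) <= 2 * D.
  move=> H; rewrite ler_pdivlMr//.
  have -> : A * (u `^ (2 * s) * h `^ (- (2 * s))) * (1 + u ^+ 2) =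
    (A * u `^ (2 * s) * (1 + u ^+ 2)) * h `^ (- (2 * s)) by ring.
  by rewrite ler_wpM2r// ltW.
have [u1|u1] := leP u 1.
  have U1 : u `^ (2 * s) <= 1.
    by rewrite -[leRHS](powRr0 u) ger_powR ?u0 ?mulr_ge0 ?(ltW s0).
  have U0 := powR_ge0 u (2 * s).
  have AU : A * u `^ (2 * s) <= D.
    by rewrite -[leRHS]mulr1 ler_pM.
  have u2 : 1 + u ^+ 2 <= 2 by have := u0; nra.
  by rewrite [leRHS]mulrC ler_pM// ?mulr_ge0// ltW.
have m1 : (1 < m)%N by rewrite -(ltr_nat R); apply: lt_le_trans sm; rewrite ltrDr.
have U : u `^ (2 * s) <= u ^+ (2 * m - 2).
  rewrite -powR_mulrn ?(ltW u0)//; apply: ler_powR; first exact: ltW.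
  rewrite natrB; last first.
    by rewrite mul2n -addnn -[2%N]/(1 + 1)%N leq_add// ltnW.
  by rewrite natrM; lra.
have {}Aw : A * (u ^+ (2 * m - 2) * u ^+ 2) <= D.
  rewrite -exprD subnK; last by rewrite mul2n -addnn -[2%N]/(1 + 1)%N leq_add// ltnW.
  by rewrite -ler_pdivlMr ?exprn_gt0//; exact: Aw.
have AU : A * u `^ (2 * s) <= A * u ^+ (2 * m - 2) by rewrite ler_wpM2l.
have AU0 : 0 <= A * u ^+ (2 * m - 2) by rewrite mulr_ge0// exprn_ge0// ltW.
apply: (@le_trans _ _ (A * u ^+ (2 * m - 2) * (2 * u ^+ 2))).
  apply: ler_pM => //; [|by rewrite ltW|].
    by rewrite mulr_ge0// powR_ge0.
  nra.
rewrite mulrCA ler_wpM2l// -mulrA//.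
Qed.

(** The squared transform of the mixture is at most [2 |F1|^2 + 2 a^2 |F2|^2], and the envelope of a
    bell of width [h] has integral of order [h^(-2s) / h]. *)
Lemma bell_mixture_energy (m : nat) (s : R) : 0 < s -> s + 1 <= m%:R ->
  exists2 K : R, 0 < K & forall t a h1 h2, 0 <= a <= 1 -> 0 < h1 -> 0 < h2 ->
    (\int[mu]_w (complex.ComplexField.Normc.normc (fourier
        (fun x => (1 - a) * bell_density m t h1 x + a * bell_density m t h2 x) w) ^+ 2
        * `|w| `^ (2 * s))%:E
      <= (K * (h1 `^ (- (2 * s + 1)) + a ^+ 2 * h2 `^ (- (2 * s + 1))))%:E)%E.
Proof.
move=> s0 sm.
have m0 : (0 < m)%N.
  by rewrite -(ltr_nat R); apply: lt_le_trans sm; rewrite ltr_pwDr// ltW.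
have [D D0 FD] := bell_density_fourier (R := R) m0.
(* The added 1 makes the constant positive, as [D] is only known to be nonnegative. *)
exists (4 * D * pi + 1) => [|t a h1 h2 /andP[a0 a1] h10 h20].
  by rewrite ltr_pwDr// !mulr_ge0// pi_ge0.
pose g (h w : R) := 2 * D * h `^ (- (2 * s)) * (1 + (h * w) ^+ 2)^-1.
have g0 h w : 0 <= g h w.
  by rewrite !mulr_ge0 ?powR_ge0// invr_ge0 addr_ge0 ?sqr_ge0.
pose A h w := complex.ComplexField.Normc.normc (fourier (bell_density m t h) w) ^+ 2.
have Ag h w : 0 < h -> A h w * `|w| `^ (2 * s) <= g h w.
  move=> h0; have [AD Aw] := FD t h w h0.
  by apply: (@bell_envelope _ D s h w m); rewrite ?sqr_ge0.
have cw (w : R) : continuous ( *%R w).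
  by move=> x; apply: cvgM; [exact: cvg_cst|exact: cvg_id].
have lin (f : R -> R) : continuous f ->
    \int[mu]_x (f x * ((1 - a) * bell_density m t h1 x + a * bell_density m t h2 x)) =
    (1 - a) * \int[mu]_x (f x * bell_density m t h1 x) +
    a * \int[mu]_x (f x * bell_density m t h2 x).
  move=> cf.
  have I1 := integrable_bell_density t m0 h10 cf.
  have I2 := integrable_bell_density t m0 h20 cf.
  rewrite -!RintegralZl// -RintegralD//.
  - by apply: eq_Rintegral => x _; ring.
  - have := @integrableZl _ _ _ mu setT measurableT (1 - a) _ I1.
    by apply: eq_integrable => // x _ /=; rewrite EFinM.
  - have := @integrableZl _ _ _ mu setT measurableT a _ I2.
    by apply: eq_integrable => // x _ /=; rewrite EFinM.
have Amix w : complex.ComplexField.Normc.normc (fourier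
        (fun x => (1 - a) * bell_density m t h1 x + a * bell_density m t h2 x) w) ^+ 2
    <= 2 * A h1 w + 2 * a ^+ 2 * A h2 w.
  have ccos : continuous (fun x : R => cos (w * x)).
    by move=> x; apply: (continuous_comp (cw w x)); exact: continuous_cos.
  have csin : continuous (fun x : R => sin (w * x)).
    by move=> x; apply: (continuous_comp (cw w x)); exact: continuous_sin.
  rewrite /A /fourier/= (lin _ ccos) (lin _ csin).
  rewrite !sqr_sqrtr ?addr_ge0 ?sqr_ge0//.
  set c1 := \int[mu]_x (cos (w * x) * bell_density m t h1 x).
  set c2 := \int[mu]_x (cos (w * x) * bell_density m t h2 x).
  set s1 := \int[mu]_x (sin (w * x) * bell_density m t h1 x).
  set s2 := \int[mu]_x (sin (w * x) * bell_density m t h2 x).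
  have sqD (x y : R) : ((1 - a) * x + a * y) ^+ 2 <= 2 * x ^+ 2 + 2 * a ^+ 2 * y ^+ 2.
    have : 0 <= ((1 - a) * x - a * y) ^+ 2 by exact: sqr_ge0.
    have : 0 <= (1 - (1 - a) ^+ 2) * x ^+ 2 by rewrite mulr_ge0 ?sqr_ge0//; nra.
    nra.
  have := sqD c1 c2; have := sqD s1 s2; nra.
apply: (@le_trans _ _ (\int[mu]_w ((2 * g h1 w)%:E + (2 * a ^+ 2 * g h2 w)%:E))%E).
  apply: le_nnintegral => w; first by rewrite lee_fin mulr_ge0 ?sqr_ge0 ?powR_ge0.
  rewrite -EFinD lee_fin.
  apply: le_trans (ler_wpM2r (powR_ge0 _ _) (Amix w)) _.
  rewrite mulrDl -[X in X + _]mulrA -[X in _ + X]mulrA; apply: lerD.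
    by apply: ler_wpM2l => //; exact: Ag.
  by apply: ler_wpM2l; [rewrite mulr_ge0 ?sqr_ge0|exact: Ag].
have cG h : continuous (fun w : R => (1 + (h * w) ^+ 2)^-1).
  move=> x; apply: (@continuous_comp _ _ _ ( *%R h) (fun y => (oneDsqr y)^-1)).
    exact: cw.
  exact: continuous_oneDsqrV.
have IZ (c h : R) : 0 <= c -> 0 < h ->
    (\int[mu]_w (c * g h w)%:E = (c * (2 * D * h `^ (- (2 * s))) * (pi / h))%:E)%E.
  move=> c0 h0; under eq_integral do rewrite /g mulrA EFinM.
  rewrite ge0_integralZl//.
  - by rewrite integralT_scaled_oneDsqrV.
  - by apply/measurable_EFinP; apply: continuous_measurable_fun; exact: cG.
  - by move=> x _; rewrite lee_fin invr_ge0 addr_ge0 ?sqr_ge0.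
  - by rewrite lee_fin !mulr_ge0 ?powR_ge0.
have mg (c h : R) : measurable_fun [set: measurableTypeR R] (fun w => (c * g h w)%:E).
  apply/measurable_EFinP; apply: continuous_measurable_fun => w.
  apply: cvgM; first exact: cvg_cst.
  by apply: cvgM; [exact: cvg_cst|exact: cG].
rewrite ge0_integralD//; last 2 first.
- by move=> w _; rewrite lee_fin mulr_ge0.
- move=> w _; rewrite lee_fin; apply: mulr_ge0 (g0 _ _).
  by apply: mulr_ge0 => //; exact: sqr_ge0.
rewrite !IZ ?mulr_ge0 ?sqr_ge0// -EFinD lee_fin.
have hE h : 0 < h -> h `^ (- (2 * s + 1)) = h `^ (- (2 * s)) / h.
  move=> h0; rewrite opprD powRD; last first.
    by apply/implyP => _; rewrite gt_eqF.
  by rewrite powR_inv1// ltW.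
rewrite !hE//.
have P1 : 0 <= h1 `^ (- (2 * s)) / h1 by rewrite divr_ge0 ?powR_ge0 ?ltW.
have P2 : 0 <= a ^+ 2 * (h2 `^ (- (2 * s)) / h2).
  by rewrite mulr_ge0 ?sqr_ge0// divr_ge0 ?powR_ge0 ?ltW.
set p1 := h1 `^ _ in P1 *; set p2 := h2 `^ _ in P2 *.
have -> : 2 * (2 * D * p1) * (pi / h1) + 2 * a ^+ 2 * (2 * D * p2) * (pi / h2) =
  4 * D * pi * (p1 / h1 + a ^+ 2 * (p2 / h2)) by ring.
by rewrite ler_wpM2r ?addr_ge0// lerDl.
Qed.

End energy.

(** * Choice of the parameters and the rate *)

Lemma probability_density_mixture (R : realType) (a : R) (f g : R -> R) :
  0 <= a <= 1 -> probability_density f -> probability_density g ->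
  probability_density (fun x => (1 - a) * f x + a * g x).
Proof.
move=> /andP[a0 a1] [mf f0 fI] [mg g0 gI].
have a1' : 0 <= 1 - a by rewrite subr_ge0.
split.
- by apply: measurable_funD; apply: measurable_funM => //; exact: measurable_cst.
- by move=> x; rewrite addr_ge0// mulr_ge0.
have mf' : measurable_fun [set: measurableTypeR R] (EFin \o f).
  exact/measurable_EFinP.
have mg' : measurable_fun [set: measurableTypeR R] (EFin \o g).
  exact/measurable_EFinP.
under eq_integral do rewrite EFinD !EFinM.
rewrite ge0_integralD//; last 4 first.
- by move=> x _; rewrite -EFinM lee_fin mulr_ge0.
- exact: measurable_funeM.
- by move=> x _; rewrite -EFinM lee_fin mulr_ge0.
- exact: measurable_funeM.
rewrite !ge0_integralZl//; try (by move=> x _; rewrite lee_fin).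
by rewrite fI gI !mule1 -EFinD subrK.
Qed.

Unset Implicit Arguments.
Set Strict Implicit.
Set Printing Implicit Defensive.

(** The constant is fixed before [t] and [n]: the bell estimates are uniform in the centre, and [n]
    enters only through the scaling of [a] and [h]. *)
Theorem proposition3p2 (R : realType) (alpha s L : R)
    (alpha_gt0 : 0 < alpha) (s_gt : 1 / 2 < s) (L_gt0 : 0 < L) :
  exists2 C : R, 0 < C &
    forall (t : R) (n : nat), (0 < n)%N ->
      ((C * n%:R `^ (- ((2 * s - 1) / (2 * s + 1))))%:E
        <= private_minimax_risk n alpha 0 s L t)%E.
Proof.
have s0 : 0 < s by lra.
pose m := (Num.truncn (s + 1)).+1.
have sm : s + 1 <= m%:R by apply: ltW; exact: truncnS_gt.
have m0 : (0 < m)%N by [].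
have [K K0 EK] := bell_mixture_energy s0 sm.
(* The energy budget [2 pi L^2] is split into two halves [K * E], one for [f0] and one for the
   perturbation; [h0] is chosen so that the bound for [f0] equals its half. *)
pose E := pi * L ^+ 2 / K.
have E0 : 0 < E by rewrite divr_gt0// mulr_gt0 ?pi_gt0// exprn_gt0.
have KE : K * E = pi * L ^+ 2 by rewrite /E mulrC divfK// gt_eqF.
have r0 : 0 < 2 * s + 1 by lra.
set r := 2 * s + 1 in r0.
pose h0 := E `^ (- r^-1).
have h00 : 0 < h0 by exact: powR_gt0.
have h0E : h0 `^ (- r) = E.
  by rewrite -powRrM mulrNN mulVf ?gt_eqF// powRr1// ltW.
pose k : R := (3 / 4) ^+ m.
have k0 : 0 < k by rewrite exprn_gt0// divr_gt0.
(* Since [f0 t <= (k * h0)^-1] and [f2 t >= (2 * h)^-1], any width [h <= k * h0 / 4] leaves a gap of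
   at least [(4 * h)^-1]. *)
pose h1 := k * h0 / 4.
have h10 : 0 < h1 by rewrite divr_gt0// mulr_gt0.
(* The bound 1 gives [a <= 1] and [n a^2 <= 1]; the other bound keeps the energy [c^2 * h1^(-r)] of
   the perturbation within [E]. *)
pose c := Num.min 1 (Num.sqrt (E * h1 `^ r)).
have Eh0 : 0 < E * h1 `^ r by rewrite mulr_gt0// powR_gt0.
have c0 : 0 < c by rewrite lt_min ltr01 sqrtr_gt0.
have c1 : c <= 1 by rewrite ge_min lexx.
have c2 : c ^+ 2 <= E * h1 `^ r.
  rewrite -[leRHS](sqr_sqrtr (ltW Eh0)) lerXn2r ?nnegrE ?sqrtr_ge0 ?(ltW c0)//.
  by rewrite ge_min lexx orbT.
pose B := expR (expR alpha) + 1.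
have B0 : 0 < B by rewrite addr_gt0// expR_gt0.
(* The squared gap without its power of [n], divided by the denominator of the two-point bound with
   [M + 1] replaced by its bound [B]. *)
exists (c ^+ 2 / (16 * h1 ^+ 2) / (2 * B)) => [|t n n0].
  by rewrite !divr_gt0// ?exprn_gt0// !mulr_gt0// exprn_gt0.
apply: le_ereal_inf_tmp => _ [d [T [Q [ell [Qpriv mell ->]]]]].
have n1 : 1 <= n%:R :> R by rewrite ler1n.
have n0' : 0 < n%:R :> R by rewrite ltr0n.
pose a := c / Num.sqrt n%:R.
pose h := h1 * n%:R `^ (- r^-1).
have sn0 : 0 < Num.sqrt n%:R :> R by rewrite sqrtr_gt0.
have a2 : a ^+ 2 = c ^+ 2 / n%:R by rewrite /a exprMn exprVn sqr_sqrtr// ltW.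
have a_gt0 : 0 < a by rewrite divr_gt0.
have a1 : a <= 1.
  rewrite ler_pdivrMr// mul1r (le_trans c1)// -[leLHS]sqrtr1 ler_sqrt//.
have a01 : 0 <= a <= 1 by rewrite a1 ltW.
have h_gt0 : 0 < h by rewrite mulr_gt0// powR_gt0.
have hh1 : h <= h1.
  rewrite ger_pMr// powRN invf_le1 ?powR_gt0// -[leLHS](powRr0 n%:R).
  by apply: ler_powR; rewrite ?invr_ge0 // ltW.
(* The powers of [n] cancel: [a^2] carries [n^-1] and [h^(-r)] carries [n]. *)
have hr : a ^+ 2 * h `^ (- r) <= E.
  rewrite a2 /h powRM ?powR_ge0 ?(ltW h10)// -powRrM mulrNN mulVf ?gt_eqF//.
  rewrite powRr1 ?(ltW n0')// powRN.
  have -> : c ^+ 2 / n%:R * ((h1 `^ r)^-1 * n%:R) = c ^+ 2 / h1 `^ r.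
    by field; rewrite !gt_eqF// powR_gt0.
  by rewrite ler_pdivrMr// powR_gt0.
pose f0 := bell_density m t h0; pose f2 := bell_density m t h.
pose f1 := fun x => (1 - a) * f0 x + a * f2 x.
have f0_sob : sobolev_ellipsoid s L f0.
  have z01 : 0 <= (0 : R) <= 1 by rewrite lexx ler01.
  split; first exact: probability_bell_density.
  (* [f0] is read as a mixture of weight 0, so the mixture bound also covers it. *)
  have := EK t 0 h0 h0 z01 h00 h00.
  have -> : (fun x => (1 - 0) * bell_density m t h0 x + 0 * bell_density m t h0 x) = f0.
    by apply/funext => x; rewrite subr0 mul1r mul0r addr0.
  move=> /le_trans; apply; rewrite lee_fin -/r h0E expr0n/= mul0r addr0 KE.
  have : 0 <= pi * L ^+ 2 by rewrite mulr_ge0 ?sqr_ge0// pi_ge0.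
  lra.
have f1_sob : sobolev_ellipsoid s L f1.
  split.
    by apply: probability_density_mixture => //; exact: probability_bell_density.
  apply: le_trans (EK t a h0 h a01 h00 h_gt0) _.
  rewrite lee_fin -/r h0E mulrDr KE.
  have : K * (a ^+ 2 * h `^ (- r)) <= pi * L ^+ 2 by rewrite -KE ler_wpM2l// ltW.
  lra.
have f2_dens := probability_bell_density t m0 h_gt0.
apply: le_trans (private_two_point_bound t Qpriv mell a01 f2_dens f0_sob f1_sob).
have cf0 : continuous f0 by exact: continuous_bell_density.
have cf1 : continuous f1.
  move=> x; apply: cvgD; apply: cvgM; try exact: cvg_cst.
    exact: cf0.
  exact: continuous_bell_density.
rewrite !continuous_version_id//= lee_fin.
have -> : (1 - a) * f0 t + a * f2 t - f0 t = a * (f2 t - f0 t) by ring.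
set M := (1 + a ^+ 2 * expR alpha) ^+ n.
have M0 : 0 <= M.
  by rewrite exprn_ge0// addr_ge0// mulr_ge0 ?sqr_ge0// expR_ge0.
(* From [1 + x <= exp x] and [n a^2 = c^2 <= 1], whence a bound free of [n]. *)
have MB : M + 1 <= B.
  rewrite lerD2r /M; apply: (@le_trans _ _ (expR (a ^+ 2 * expR alpha) ^+ n)).
    rewrite lerXn2r ?nnegrE ?expR_ge0 ?expR_ge1Dx//.
    by rewrite addr_ge0// mulr_ge0 ?sqr_ge0// expR_ge0.
  rewrite -expRM_natl ler_expR a2 mulrA mulrCA divff ?gt_eqF// mulr1.
  by rewrite ler_piMl ?expR_ge0// expr_le1// ltW.
have /andP[f2t _] := bell_density_center t m0 h_gt0.
have /andP[_ f0t] := bell_density_center t m0 h00.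
have gap : (4 * h)^-1 <= f2 t - f0 t.
  have kh : (k * h0)^-1 <= (4 * h)^-1.
    have kh0 : 0 < k * h0 by rewrite mulr_gt0.
    have h40 : 0 < 4 * h by rewrite mulr_gt0.
    rewrite lef_pV2 ?posrE//; move: hh1; rewrite /h1; lra.
  have hE : (4 * h)^-1 = (2 * h)^-1 - (4 * h)^-1 by field; rewrite gt_eqF.
  by rewrite hE; apply: lerB f2t (le_trans f0t kh).
(* An exact identity: [a^2] contributes [n^-1], [h^-2] contributes [n^(2/r)], and [2/r - 1] is the
   exponent of the rate. *)
have rate : c ^+ 2 / (16 * h1 ^+ 2) * n%:R `^ (- ((2 * s - 1) / r)) =
    (a * (4 * h)^-1) ^+ 2.
  have -> : - ((2 * s - 1) / r) = r^-1 * 2 - 1.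
    by rewrite /r; field; rewrite gt_eqF.
  rewrite powRB; last by apply/implyP => _; rewrite gt_eqF.
  rewrite powRr1 ?(ltW n0')// powRrM powR_mulrn ?powR_ge0//.
  have -> : (a * (4 * h)^-1) ^+ 2 = a ^+ 2 / (16 * h ^+ 2) by field; rewrite gt_eqF.
  have pn : 0 < n%:R `^ r^-1 by exact: powR_gt0.
  rewrite a2 /h powRN (exprMn 2 h1).
  by field; rewrite !gt_eqF.
rewrite [leLHS]mulrAC -/r rate.
apply: ler_pM; rewrite ?sqr_ge0 ?invr_ge0 ?mulr_ge0 ?(ltW B0)//.
  have g0 : 0 <= a * (4 * h)^-1.
    by rewrite mulr_ge0 ?(ltW a_gt0)// invr_ge0 mulr_ge0// ltW.
  have ag : a * (4 * h)^-1 <= a * (f2 t - f0 t) by apply: ler_wpM2l gap; exact: ltW.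
  by rewrite lerXn2r ?nnegrE// (le_trans g0 ag).
have M10 : 0 < M + 1 by rewrite ltr_wpDl.
by rewrite lef_pV2 ?posrE ?mulr_gt0// ler_wpM2l.
Qed.
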